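(* Let $1\le p<2$ be a constant. Let $\epsilon>0$ and $\delta>0$ be smaller than sufficiently small absolute constants, and let $n$ be sufficiently large (at least a suitable constant multiple of $\epsilon^{-2}\log(1/\delta)$). Then any linear sketch that $(\epsilon,\delta)$-approximates $F_p(x)=\sum_{i=1}^n|x_i|^p$ for every $x\in\mathbb{R}^n$ must have sketching dimension $r=\Omega(\epsilon^{-2}\log(1/\delta))$.
   Context: A linear sketch is a distribution over real matrices $S\in\mathbb{R}^{r\times n}$ together with an estimator that, given $S$ and $Sx$, outputs $\hat F_p$; its sketching dimension is the maximum number $r$ of rows. It $(\epsilon,\delta)$-approximates $F_p$ if for every fixed $x\in\mathbb{R}^n$, $\Pr[|\hat F_p-F_p(x)|\le\epsilon F_p(x)]\ge 1-\delta$. *)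

(* Defs.v *)
From HB Require Import structures.
From mathcomp Require Import all_boot all_order all_algebra.
From mathcomp Require Import all_classical all_reals all_analysis.
From mathcomp Require Import ess_sup_inf.

Set Implicit Arguments.
Unset Strict Implicit.
Unset Printing Implicit Defensive.

Import Order.TTheory GRing.Theory Num.Theory.
Import numFieldNormedType.Exports.

Local Open Scope classical_set_scope.
Local Open Scope ring_scope.

(* The sigma-algebra on m x n matrices generated by the entries; for real
   entries this is the Borel sigma-algebra. *)

Definition measure_mx_display : measure_display -> measure_display.
Proof. exact. Qed.

Section measurable_matrix.
Context {d : measure_display} {T : measurableType d}.
Variables m n : nat.

Definition mx_measurable : set (set 'M[T]_(m, n)) :=
  <<s \bigcup_(ij in [set: 'I_m * 'I_n])
        preimage_set_system setT (fun M : 'M[T]_(m, n) => M ij.1 ij.2)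
          measurable >>.

Let mx_measurable0 : mx_measurable set0.
Proof. exact: sigma_algebra0. Qed.

Let mx_measurableC A : mx_measurable A -> mx_measurable (~` A).
Proof. exact: sigma_algebraC. Qed.

Let mx_measurable_bigcup (F : (set 'M[T]_(m, n))^nat) :
  (forall i, mx_measurable (F i)) -> mx_measurable (\bigcup_i F i).
Proof. exact: sigma_algebra_bigcup. Qed.

HB.instance Definition _ := @isMeasurable.Build (measure_mx_display d)
  'M[T]_(m, n) mx_measurable mx_measurable0 mx_measurableC
  mx_measurable_bigcup.

End measurable_matrix.

(* Matrices with n columns and an arbitrary number of rows: the disjoint union
   of the spaces 'M[T]_(m, n) over m, with the sum sigma-algebra. *)

Definition varmx (T : Type) (n : nat) : Type := {m : nat & 'M[T]_(m, n)}.

Definition measure_varmx_display : measure_display -> measure_display.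
Proof. exact. Qed.

Section measurable_varmx.
Context {d : measure_display} {T : measurableType d}.
Variable n : nat.

Definition VarMx (m : nat) (M : 'M[T]_(m, n)) : varmx T n := existT _ m M.

HB.instance Definition _ := gen_eqMixin (varmx T n).
HB.instance Definition _ := gen_choiceMixin (varmx T n).
HB.instance Definition _ :=
  isPointed.Build (varmx T n) (VarMx (point : 'M[T]_(0, n))).

Definition varmx_measurable : set (set (varmx T n)) :=
  [set A | forall m, measurable (@VarMx m @^-1` A)].

Let varmx_measurable0 : varmx_measurable set0.
Proof. by move=> m; rewrite preimage_set0. Qed.

Let varmx_measurableC A : varmx_measurable A -> varmx_measurable (~` A).
Proof. by move=> mA m; rewrite preimage_setC; exact: measurableC (mA m). Qed.

Let varmx_measurable_bigcup (F : (set (varmx T n))^nat) :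
  (forall i, varmx_measurable (F i)) -> varmx_measurable (\bigcup_i F i).
Proof.
move=> mF m; rewrite preimage_bigcup.
by apply: bigcupT_measurable => i; exact: mF.
Qed.

HB.instance Definition _ := @isMeasurable.Build (measure_varmx_display d)
  (varmx T n) varmx_measurable varmx_measurable0 varmx_measurableC
  varmx_measurable_bigcup.

End measurable_varmx.

(* The number of rows may vary with the outcome S.  The estimator is a
   probability kernel, so it may be randomized, with randomness independent of
   S; a deterministic measurable estimator is the Dirac kernel (kdirac). *)
Record linear_sketch (R : realType) (n : nat) := LinearSketch {
  sketch_dist : probability (varmx R n) R ;
  estimator : forall m : nat, R.-pker ('M[R]_(m, n) * 'cV[R]_m) ~> R }.

Section linear_sketch.
Context {R : realType} {n : nat}.
Implicit Types (L : linear_sketch R n) (x : 'cV[R]_n).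

Definition moment (p : R) x : R := \sum_(i < n) `|x i ord0| `^ p.

(* Pr[Fhat \in A], where Fhat is the output of the sketch on input x. *)
Definition output_prob L x (A : set R) : \bar R :=
  (\int[sketch_dist L]_(S in setT)
     estimator L (tag S) (tagged S, tagged S *m x) A)%E.

Definition approximates_moment (p eps delta : R) L : Prop :=
  forall x, ((1 - delta)%:E <=
    output_prob L x
      [set y : R | (`|y - moment p x| <= eps * moment p x)%R])%E.

(* The maximum number of rows over the support of the distribution (+oo when
   the number of rows is unbounded). *)
Definition sketching_dim L : \bar R :=
  ess_sup (sketch_dist L) (fun S => ((tag S)%:R)%:E).

End linear_sketch.

(* Main.v *)
(* Two inputs are compared: a standard Gaussian vector x and its dilation a x
   with a = 1 + 8 eps.  By Chernoff's bound F_p(x) is within a factor 1 +- eps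
   of n E|x_1|^p with probability at least 1 - delta, and F_p(a x) = a^p F_p(x)
   with a^p >= a, so an accurate sketch tells x from a x by a threshold.  For a
   fixed S with m rows, Givens rotations show that S x has the law of A w with
   w standard Gaussian in dimension m and A square; hence S (a x) is A (a w),
   and the likelihood ratio of a w against w has second moment
   (1 - (a^2 - 1)^2)^(-m/2) <= exp (m (a^2 - 1)^2).  Telling x from a x with
   error delta requires this to be of order 1/delta, that is
   m >= c eps^-2 ln (1/delta). *)
Require Import Defs.
From HB Require Import structures.
From mathcomp Require Import all_boot all_order all_algebra.
From mathcomp Require Import all_classical all_reals all_analysis.
From mathcomp Require Import measurable_realfun ess_sup_inf.
From mathcomp Require Import ring lra.

Set Implicit Arguments.
Unset Strict Implicit.
Unset Printing Implicit Defensive.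

Import Order.TTheory GRing.Theory Num.Theory.
Import numFieldNormedType.Exports.

Local Open Scope classical_set_scope.
Local Open Scope ring_scope.
Local Open Scope ereal_scope.

(** Comparing the two laws in total variation would only exclude a constant error and lose the
    factor [ln (1/delta)]. The second moment of the likelihood ratio resolves errors of size
    [delta], since it must grow with [1/delta] before the test becomes possible. It differs from 1
    only to order [(a^2 - 1)^2], with no linear term: this is the source of [eps^-2]. The estimator
    knows [S], so the laws are compared for each [S] separately, after the accuracy guarantee, which
    is given input by input, has been averaged over the Gaussian input. Neither the rank nor the
    shape of [S] is controlled; equality in law with a square matrix avoids choosing a basis of its
    row space and makes the number of rows, instead of [n], the dimension in the exponent. *)

Lemma integral_probability_cst d (T : measurableType d) (R : realType)
    (P : probability T R) (r : \bar R) : \int[P]_x cst r x = r.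
Proof.
rewrite integral_cst//= -[RHS]mule1; congr (_ * _).
exact: probability_setT.
Qed.

(** * Affine substitution in Lebesgue integrals *)

Section lebesgue_affine.
Context {R : realType}.
Local Notation mu := (@lebesgue_measure R).
Variables (a b : R).
Hypothesis a0 : (0 < a)%R.

Let phi (x : measurableTypeR R) : measurableTypeR R := (a * x + b)%R.

Let mphi : measurable_fun [set: measurableTypeR R] phi.
Proof. by apply: measurable_funD => //; exact: measurable_funM. Qed.

Let preimage_itv (c d : R) :
  phi @^-1` `]c, d] = `]((c - b) / a)%R, ((d - b) / a)%R]%classic.
Proof.
apply/seteqP; split => x /=; rewrite !in_itv /phi/=;
  by rewrite ltr_pdivrMr// ler_pdivlMr// (mulrC x) ltrBlDr lerBrDr.
Qed.

Let a0' : (0 <= a)%R := ltW a0.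

Let nu : {measure set (measurableTypeR R) -> \bar R} :=
  mscale (NngNum a0') (measure_function_pushforward__canonical__measure_function_Measure mu mphi).

(** Half-open intervals determine Lebesgue measure. The preimage of such an interval under [phi] is
    shorter by the factor [a], which the scaling in [nu] restores. *)
Let lebesgue_affine A : measurable A -> mu A = nu A.
Proof.
move: A; apply: lebesgue_measure_unique => X /ocitvP[->|[[c d]/= cd ->]].
  by rewrite !measure0.
rewrite /nu /mscale/= /pushforward preimage_itv !lebesgue_measure_itv/= !lte_fin.
rewrite ltr_pM2r ?invr_gt0// ltrD2r cd -!EFinD -EFinM; congr EFin.
by field; rewrite gt_eqF.
Qed.

Lemma ge0_integral_affine (f : R -> \bar R) :
  measurable_fun setT f -> (forall x, 0 <= f x) ->
  \int[mu]_x f x = a%:E * \int[mu]_x f (a * x + b)%R.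
Proof.
move=> mf f0.
transitivity (\int[nu]_x f x).
  by apply: eq_measure_integral => A mA _; exact: lebesgue_affine.
rewrite ge0_integral_mscale//= ge0_integral_pushforward//.
Qed.

End lebesgue_affine.

(** * The standard Gaussian on the line and its dilations *)

Section gaussian.
Context {R : realType}.
Local Notation mu := (@lebesgue_measure R).
Local Notation pdf := (normal_pdf (0:R)%R (1:R)%R).

(* [gauss1] lives on [R] with its default measurable structure, which is the one
   matrix entries carry, and not on [measurableTypeR R]. *)
Definition gauss1 : set R -> \bar R :=
  pushforward (normal_prob (0:R)%R (1:R)%R) (id : measurableTypeR R -> R).

Let measurable_id_realType : measurable_fun setT (id : measurableTypeR R -> R).
Proof. by []. Qed.

HB.instance Definition _ := Measure.copy gauss1
  (measure_function_pushforward__canonical__measure_function_Measure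
    (normal_prob (0:R)%R (1:R)%R) measurable_id_realType).

Let gauss1_setT : gauss1 setT = 1.
Proof. exact: (@probability_setT _ _ _ (normal_prob (0:R)%R (1:R)%R)). Qed.

HB.instance Definition _ := Measure_isProbability.Build _ _ _ gauss1 gauss1_setT.

(** Change of variables gives the formula with the Radon-Nikodym derivative of [normal_prob]; that
    derivative and [pdf] have the same integral over every measurable set, hence agree almost
    everywhere. *)
Lemma ge0_integral_gauss1 (f : R -> \bar R) :
  measurable_fun setT f -> (forall x, 0 <= f x) ->
  \int[gauss1]_x f x = \int[mu]_x (f x * (pdf x)%:E).
Proof.
move=> mf f0; rewrite ge0_integral_pushforward//= preimage_setT.
have dom : normal_prob (0:R)%R (1:R)%R `<< mu by exact: normal_prob_dominates.
pose nu : {finite_measure set (measurableTypeR R) -> \bar R} := normal_prob (0:R)%R (1:R)%R.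
have mf' : measurable_fun [set: measurableTypeR R] f by [].
have -> : \int[normal_prob 0%R 1%R]_x (f \o id) x = \int[nu]_x f x by [].
rewrite -(Radon_Nikodym_SigmaFinite.change_of_variables dom)//.
have mpdf : measurable_fun setT (EFin \o pdf).
  by apply/measurable_EFinP; exact: measurable_normal_pdf.
have mRN : measurable_fun setT (Radon_Nikodym_SigmaFinite.f nu mu).
  exact/measurable_int/Radon_Nikodym_SigmaFinite.f_integrable.
apply: ge0_ae_eq_integral => //.
- exact: emeasurable_funM.
- exact: emeasurable_funM.
- move=> x _; rewrite mule_ge0//; exact: Radon_Nikodym_SigmaFinite.f_ge0.
- by move=> x _; rewrite mule_ge0// lee_fin normal_pdf_ge0.
- have : ae_eq mu setT (Radon_Nikodym_SigmaFinite.f nu mu) (EFin \o pdf).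
    apply: integral_ae_eq => //.
    + exact: Radon_Nikodym_SigmaFinite.f_integrable.
    + by move=> A _ mA; rewrite -Radon_Nikodym_SigmaFinite.f_integral.
  by apply: filterS => x /= H /H ->.
Qed.

Lemma normal_pdf01E x :
  pdf x = (normal_peak 1 * expR (- x ^+ 2 / 2))%R.
Proof. by rewrite normal_pdfE ?oner_eq0// /normal_fun subr0 expr1n. Qed.

(** The likelihood ratio [pdf (x / a) / (a * pdf x)] of the dilated Gaussian against the standard
    one. *)
Definition scale_ratio (a x : R) : R := expR ((1 - a ^- 2) / 2 * x ^+ 2) / a.

Lemma measurable_scale_ratio a : measurable_fun setT (scale_ratio a).
Proof.
apply: measurable_funM => //; apply: measurableT_comp => //.
by apply: measurable_funM => //; exact: measurable_funX.
Qed.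

(** Substituting [a * x] for [x] on the right, the Jacobian [a] cancels the denominator of the ratio
    and the two exponents add up to [- x ^+ 2 / 2]. *)
Lemma ge0_integral_gauss1_scale (a : R) (f : R -> \bar R) : (0 < a)%R ->
  measurable_fun setT f -> (forall x, 0 <= f x) ->
  \int[gauss1]_x f (a * x)%R = \int[gauss1]_x (f x * (scale_ratio a x)%:E).
Proof.
move=> a0 mf f0.
have mpdf : measurable_fun setT (EFin \o pdf).
  by apply/measurable_EFinP; exact: measurable_normal_pdf.
have mr : measurable_fun setT (fun x => (scale_ratio a x)%:E).
  by apply/measurable_EFinP; exact: measurable_scale_ratio.
have r0 x : 0 <= (scale_ratio a x)%:E.
  by rewrite lee_fin mulr_ge0 ?expR_ge0// invr_ge0 ltW.
rewrite ge0_integral_gauss1//; last first.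
  by apply: measurableT_comp => //; exact: measurable_funM.
rewrite [RHS]ge0_integral_gauss1//; last 2 first.
- exact: emeasurable_funM.
- by move=> x; rewrite mule_ge0.
rewrite [RHS](ge0_integral_affine 0%R a0); last 2 first.
- by apply: emeasurable_funM => //; exact: emeasurable_funM.
- by move=> x; rewrite !mule_ge0// lee_fin normal_pdf_ge0.
rewrite -ge0_integralZl_EFin//; last 3 first.
- by move=> x _; rewrite !mule_ge0// lee_fin normal_pdf_ge0.
- apply: (@measurableT_comp _ _ _ _ _ _ (fun x => f x * (scale_ratio a x)%:E * (pdf x)%:E)).
    by apply: emeasurable_funM => //; exact: emeasurable_funM.
  by apply: measurable_funD => //; exact: measurable_funM.
- exact: ltW.
apply: eq_integral => x _ /=; rewrite addr0 -[in RHS]muleA [RHS]muleCA; congr (_ * _).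
rewrite -!EFinM; congr EFin; rewrite !normal_pdf01E /scale_ratio.
set k := normal_peak 1.
have -> : (a * (expR ((1 - a ^- 2) / 2 * (a * x) ^+ 2) / a * (k * expR (- (a * x) ^+ 2 / 2))) =
  k * (expR ((1 - a ^- 2) / 2 * (a * x) ^+ 2) * expR (- (a * x) ^+ 2 / 2)))%R.
  by field; rewrite gt_eqF.
rewrite -expRD; congr (_ * expR _)%R.
by field; rewrite gt_eqF.
Qed.

End gaussian.

Section gaussian_moment.
Context {R : realType}.

(** Every [c] below 1/2 is [(1 - a ^- 2) / 2] for a suitable [a], so the integrand is [a] times a
    likelihood ratio, whose integral is 1. *)
Lemma integral_gauss1_expR_sqr (c : R) : (c < 2^-1)%R ->
  \int[@gauss1 R]_x (expR (c * x ^+ 2))%:E = ((Num.sqrt (1 - c *+ 2))^-1)%:E.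
Proof.
move=> c2; set a := ((Num.sqrt (1 - c *+ 2))^-1)%R.
have c0 : (0 < 1 - c *+ 2)%R by lra.
have a0 : (0 < a)%R by rewrite invr_gt0 sqrtr_gt0.
have ca : (c = (1 - a ^- 2) / 2)%R.
  by rewrite /a exprVn invrK sqr_sqrtr ?ltW//; lra.
have := @ge0_integral_gauss1_scale R a (cst 1) a0 (@measurable_cst _ _ _ _ _ _) (fun=> lee01).
rewrite integral_probability_cst => /(congr1 (fun u => a%:E * u)); rewrite mule1 => ->.
rewrite -ge0_integralZl_EFin//=.
- by apply: eq_integral => x _; rewrite mul1e -EFinM ca /scale_ratio [(a * _)%R]mulrC divfK// gt_eqF.
- by move=> x _; rewrite mul1e lee_fin mulr_ge0 ?expR_ge0// invr_ge0 ltW.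
- under eq_fun do rewrite mul1e.
  by apply/measurable_EFinP; exact: measurable_scale_ratio.
- exact: ltW.
Qed.

End gaussian_moment.

(** * Rotation invariance of the Gaussian in the plane *)

Section gaussian_rotation.
Context {R : realType}.
Local Notation mu := (@lebesgue_measure R).
Local Notation T := (measurableTypeR R).
Local Notation pdf := (normal_pdf (0:R)%R (1:R)%R).

Let measurable_affine (a b : R) (f g : T * T -> T) :
  measurable_fun setT f -> measurable_fun setT g ->
  measurable_fun setT (fun z => (a * f z + b * g z)%R).
Proof. by move=> mf mg; apply: measurable_funD; exact: measurable_funM. Qed.

Let measurable_lin2 (a b c d : R) :
  measurable_fun setT (fun z : T * T =>
    ((a * z.1 + b * z.2)%R : T, (c * z.1 + d * z.2)%R : T)).
Proof.
by apply: measurable_fun_pair; apply: measurable_affine;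
  [exact: measurable_fst|exact: measurable_snd|exact: measurable_fst|exact: measurable_snd].
Qed.

Let shear_snd (b : R) (g : T * T -> \bar R) :
  measurable_fun setT g -> (forall z, 0 <= g z) ->
  \int[mu]_s \int[mu]_t g (s, t) = \int[mu]_s \int[mu]_t g (s, (t + b * s)%R : T).
Proof.
move=> mg g0; apply: eq_integral => s _.
rewrite (@ge0_integral_affine _ 1%R (b * s)%R ltr01); last 2 first.
- exact: measurable_fun_pair2.
- by [].
by rewrite mul1e; apply: eq_integral => t _; rewrite mul1r.
Qed.

Let shear_fst (a : R) (g : T * T -> \bar R) :
  measurable_fun setT g -> (forall z, 0 <= g z) ->
  \int[mu]_s \int[mu]_t g (s, t) = \int[mu]_s \int[mu]_t g ((s + a * t)%R : T, t).
Proof.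
move=> mg g0; rewrite (fubini_tonelli (m1 := mu) (m2 := mu) g mg g0).
have mg' : measurable_fun setT (fun z : T * T => g ((z.1 + a * z.2)%R : T, z.2)).
  rewrite (_ : (fun z => _) = g \o (fun z : T * T =>
    ((1 * z.1 + a * z.2)%R : T, (0 * z.1 + 1 * z.2)%R : T))); last first.
    by apply/funext => z /=; rewrite !mul1r mul0r add0r.
  by apply: measurableT_comp => //; exact: measurable_lin2.
rewrite [RHS](fubini_tonelli (m1 := mu) (m2 := mu) (fun z : T * T => g ((z.1 + a * z.2)%R : T, z.2)) mg' (fun z => g0 _)).
apply: eq_integral => t _.
rewrite (@ge0_integral_affine _ 1%R (a * t)%R ltr01); last 2 first.
- exact: measurable_fun_pair1.
- by [].
by rewrite mul1e; apply: eq_integral => s _; rewrite mul1r.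
Qed.

(* A rotation is a product of three shears, which preserve area. *)
Let rotation (c d : R) (g : T * T -> \bar R) :
  (d != 0)%R -> (c ^+ 2 + d ^+ 2 = 1)%R ->
  measurable_fun setT g -> (forall z, 0 <= g z) ->
  \int[mu]_s \int[mu]_t g (s, t) =
  \int[mu]_s \int[mu]_t g ((c * s - d * t)%R : T, (d * s + c * t)%R : T).
Proof.
(* With this slope the shears by [a], [d] and [a] compose to the rotation: the diagonal entries are
   [1 + a * d = c] and the upper right one is [a * (c + 1) = - d]. *)
move=> d0 cd mg g0; pose a := ((c - 1) / d)%R.
have mU h : measurable_fun setT h -> measurable_fun setT
    (fun z : T * T => h ((z.1 + a * z.2)%R : T, z.2) : \bar R).
  move=> mh; rewrite (_ : (fun z => _) = h \o (fun z : T * T =>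
    ((1 * z.1 + a * z.2)%R : T, (0 * z.1 + 1 * z.2)%R : T))); last first.
    by apply/funext => z /=; rewrite !mul1r mul0r add0r.
  by apply: measurableT_comp => //; exact: measurable_lin2.
have mL h : measurable_fun setT h -> measurable_fun setT
    (fun z : T * T => h (z.1, (z.2 + d * z.1)%R : T) : \bar R).
  move=> mh; rewrite (_ : (fun z => _) = h \o (fun z : T * T =>
    ((1 * z.1 + 0 * z.2)%R : T, (d * z.1 + 1 * z.2)%R : T))); last first.
    by apply/funext => z /=; rewrite !mul1r mul0r addr0 addrC; case: z.
  by apply: measurableT_comp => //; exact: measurable_lin2.
have mUg := mU _ mg; have mLUg := mL _ mUg.
rewrite (shear_fst a mg g0).
have Ug0 (z : T * T) : 0 <= g ((z.1 + a * z.2)%R : T, z.2) by exact: g0.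
rewrite (shear_snd d mUg Ug0).
rewrite (shear_fst a mLUg (fun z => Ug0 (z.1, (z.2 + d * z.1)%R : T))).
apply: eq_integral => s _; apply: eq_integral => t _ /=; congr (g (_, _)).
  have -> : ((c * s - d * t) = c * s + (c ^+ 2 - 1) / d * t)%R.
    by rewrite -cd opprD addrA subrr add0r; field.
  by rewrite /a; field.
by rewrite /a; field.
Qed.

Lemma gauss1_integral2E (f : R * R -> \bar R) :
  measurable_fun setT f -> (forall z, 0 <= f z) ->
  \int[@gauss1 R]_s \int[@gauss1 R]_t f (s, t) =
  \int[mu]_s \int[mu]_t (f (s, t) * (normal_peak 1 ^+ 2 * expR (- (s ^+ 2 + t ^+ 2) / 2))%:E).
Proof.
move=> mf f0; rewrite ge0_integral_gauss1; last 2 first.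
- exact: measurable_fun_fubini_tonelli_F.
- by move=> s; exact: integral_ge0.
have mpdf : measurable_fun setT (EFin \o pdf).
  by apply/measurable_EFinP; exact: measurable_normal_pdf.
apply: eq_integral => s _.
have mfs : measurable_fun setT (fun t => f (s, t)) by exact: measurable_fun_pair2.
rewrite ge0_integral_gauss1// -ge0_integralZr//; last 3 first.
- exact: emeasurable_funM.
- by move=> x _; rewrite mule_ge0// lee_fin normal_pdf_ge0.
- by rewrite lee_fin normal_pdf_ge0.
apply: eq_integral => t _; rewrite -muleA -EFinM; congr (_ * _%:E).
rewrite !normal_pdf01E expr2 mulrACA -expRD; congr (_ * expR _)%R; lra.
Qed.

(** The joint density depends on [s ^+ 2 + t ^+ 2] alone, so the invariance of area carries over. *)
Lemma gauss1_rotation (c d : R) (f : R * R -> \bar R) :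
  (c ^+ 2 + d ^+ 2 = 1)%R -> (d != 0)%R ->
  measurable_fun setT f -> (forall z, 0 <= f z) ->
  \int[@gauss1 R]_s \int[@gauss1 R]_t f ((c * s - d * t)%R, (d * s + c * t)%R) =
  \int[@gauss1 R]_s \int[@gauss1 R]_t f (s, t).
Proof.
move=> cd d0 mf f0; pose h z := (c * z.1 - d * z.2 : R, d * z.1 + c * z.2 : R)%R.
have mh : measurable_fun setT h.
  apply: measurable_fun_pair; [apply: measurable_funB|apply: measurable_funD];
    exact: measurable_funM.
have mfh : measurable_fun setT (f \o h) by exact: measurableT_comp.
rewrite (gauss1_integral2E mfh (fun z => f0 (h z))).
rewrite (gauss1_integral2E mf f0).
pose g (z : T * T) := f (z.1 : R, z.2 : R) *
  (normal_peak 1 ^+ 2 * expR (- (z.1 ^+ 2 + z.2 ^+ 2) / 2))%:E.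
rewrite [RHS](@rotation c d g d0 cd); last 2 first.
- apply: emeasurable_funM.
    rewrite (_ : (fun _ => _) = f \o (fun z : T * T => (z.1 : R, z.2 : R))).
      apply: measurableT_comp => //.
      by apply: measurable_fun_pair; [exact: measurable_fst|exact: measurable_snd].
    by apply/funext => -[].
  apply/measurable_EFinP; apply: measurable_funM => //.
  apply: measurableT_comp => //; apply: measurable_funM => //.
  apply: measurableT_comp => //; apply: measurable_funD;
    exact: measurable_funX.
- by move=> z; rewrite mule_ge0// lee_fin mulr_ge0 ?expR_ge0// exprn_ge0 ?normal_peak_ge0.
apply: eq_integral => s _; apply: eq_integral => t _ /=.
have E : ((c * s - d * t) ^+ 2 + (d * s + c * t) ^+ 2 = s ^+ 2 + t ^+ 2)%R.
  rewrite -[RHS]mul1r -cd; ring.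
by rewrite /g /= E.
Qed.

End gaussian_rotation.

(** * Measurability of matrix operations *)

Section measurable_matrix_functions.
Context {R : realType}.

Lemma measurable_mx_entry m n (i : 'I_m) (j : 'I_n) :
  measurable_fun setT (fun M : 'M[R]_(m, n) => M i j).
Proof.
move=> _ Y mY; rewrite setTI; apply: sub_sigma_algebra.
by exists (i, j) => //; exists Y => //; rewrite setTI.
Qed.

Lemma measurable_fun_mx d (T : measurableType d) m n (f : T -> 'M[R]_(m, n)) :
  (forall i j, measurable_fun setT (fun x => f x i j)) -> measurable_fun setT f.
Proof.
move=> mf; apply: (measurability (\bigcup_(ij in [set: 'I_m * 'I_n])
   preimage_set_system setT (fun M : 'M[R]_(m, n) => M ij.1 ij.2) measurable)) => //.
move=> _ [_ [[i j] _ [Y mY <-]] <-]/=; rewrite setTI.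
exact: mf.
Qed.

Lemma measurable_fun_mulmx d (T : measurableType d) m n p
    (f : T -> 'M[R]_(m, n)) (g : T -> 'M[R]_(n, p)) :
  measurable_fun setT f -> measurable_fun setT g ->
  measurable_fun setT (fun x => f x *m g x).
Proof.
move=> mf mg; apply: measurable_fun_mx => i j.
under eq_fun do rewrite mxE.
apply: measurable_sum => k; apply: measurable_funM.
  exact: (measurableT_comp (measurable_mx_entry i k)).
exact: (measurableT_comp (measurable_mx_entry k j)).
Qed.

Lemma measurable_mulmx m n p (A : 'M[R]_(m, n)) :
  measurable_fun setT (fun x : 'M[R]_(n, p) => A *m x).
Proof. exact: measurable_fun_mulmx. Qed.

Lemma measurable_fun_scalemx d (T : measurableType d) m n (a : R)
    (f : T -> 'M[R]_(m, n)) :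
  measurable_fun setT f -> measurable_fun setT (fun x => a *: f x)%R.
Proof.
move=> mf; apply: measurable_fun_mx => i j; under eq_fun do rewrite mxE.
apply: measurable_funM => //.
exact: (measurableT_comp (measurable_mx_entry i j) mf).
Qed.

Lemma measurable_scalemx m n (a : R) :
  measurable_fun setT (fun x : 'M[R]_(m, n) => a *: x)%R.
Proof. exact: measurable_fun_scalemx. Qed.

End measurable_matrix_functions.

(** * Standard Gaussian vectors *)

Section gaussian_vector.
Context {R : realType}.

(** Written as a block column so that a product with a [row_mx] splits off the first column of the
    matrix. *)
Definition vcons n (z : R * 'cV[R]_n) : 'cV[R]_n.+1 := col_mx z.1%:M z.2.

Lemma vcons0 n z : @vcons n z ord0 ord0 = z.1.
Proof.
transitivity (col_mx z.1%:M z.2 (lshift n (ord0 : 'I_1)) ord0).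
  by congr (fun_of_matrix _ _ _); exact: val_inj.
by rewrite col_mxEu !mxE eqxx mulr1n.
Qed.

Lemma vconsS n z (i : 'I_n) : vcons z (lift ord0 i) ord0 = z.2 i ord0.
Proof.
transitivity (col_mx z.1%:M z.2 (rshift 1 i) ord0).
  by congr (fun_of_matrix _ _ _); exact: val_inj.
by rewrite col_mxEd.
Qed.

Lemma measurable_vcons n : measurable_fun setT (@vcons n).
Proof.
apply: measurable_fun_mx => i j; rewrite ord1.
case: (unliftP ord0 i) => [k|] ->.
  under eq_fun do rewrite vconsS.
  exact: (measurableT_comp (measurable_mx_entry k ord0)).
under eq_fun do rewrite vcons0.
exact: measurable_fst.
Qed.

HB.instance Definition _ n :=
  isMeasurableFun.Build _ _ _ _ (@vcons n) (@measurable_vcons n).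

(** Adding one independent coordinate at a time lets Tonelli's theorem peel off the first one, so
    that facts about [gauss n] go by induction on [n]. *)
Fixpoint gauss n : probability 'cV[R]_n R :=
  if n is n'.+1 then distribution (gauss1 \x gauss n') (@vcons n')
  else dirac (0%R : 'cV[R]_0).

Lemma ge0_integral_gauss0 (f : 'cV[R]_0 -> \bar R) :
  measurable_fun setT f -> \int[gauss 0]_x f x = f 0%R.
Proof. by move=> mf; rewrite /= integral_dirac//= diracT mul1e. Qed.

Lemma ge0_integral_gaussS n (f : 'cV[R]_n.+1 -> \bar R) :
  measurable_fun setT f -> (forall x, 0 <= f x) ->
  \int[gauss n.+1]_x f x =
  \int[gauss1]_t \int[gauss n]_x f (vcons (t, x)).
Proof.
move=> mf f0; rewrite ge0_integral_distribution//.
have mfv : measurable_fun setT (f \o @vcons n).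
  by apply: measurableT_comp => //; exact: measurable_vcons.
exact: (fubini_tonelli1 (f \o @vcons n) mfv (fun z => f0 (vcons z))).
Qed.

(** Independence of the coordinates; it serves both the second moment of the likelihood ratio and
    Chernoff's bound. *)
Lemma integral_gauss_prod n (f : R -> \bar R) : measurable_fun setT f ->
  (forall x, 0 <= f x) ->
  \int[gauss n]_x \prod_(i < n) f (x i ord0) = (\int[gauss1]_t f t) ^+ n.
Proof.
move=> mf f0.
have mprod k : measurable_fun setT (fun x : 'cV[R]_k => \prod_(i < k) f (x i ord0)).
  elim: k => [|k IH].
    by under eq_fun do rewrite big_ord0; exact: measurable_cst.
  under eq_fun do rewrite big_ord_recl.
  apply: emeasurable_funM.
    exact: (measurableT_comp mf (measurable_mx_entry ord0 ord0)).
  pose tl (x : 'cV[R]_k.+1) : 'cV[R]_k := (\col_i x (lift ord0 i) ord0)%R.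
  rewrite (_ : (fun _ => _) = (fun x : 'cV[R]_k => \prod_(i < k) f (x i ord0)) \o tl).
    apply: measurableT_comp => //; apply: measurable_fun_mx => i j.
    under eq_fun do rewrite mxE.
    exact: measurable_mx_entry.
  by apply/funext => x /=; apply: eq_bigr => i _; rewrite mxE.
have prod0 k (x : 'cV[R]_k) : 0 <= \prod_(i < k) f (x i ord0).
  by elim/big_ind : _ => // *; exact: mule_ge0.
elim: n => [|n IH].
  by rewrite ge0_integral_gauss0// big_ord0.
rewrite ge0_integral_gaussS// expeS -ge0_integralZr//; last first.
  by rewrite expe_ge0// integral_ge0.
apply: eq_integral => t _.
under eq_integral => x _.
  rewrite big_ord_recl vcons0/=.
  under eq_bigr do rewrite vconsS/=.
  over.
rewrite /= ge0_integralZl//; first by congr (_ * _); exact: IH.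
- exact: mprod.
- by move=> x _; exact: prod0.
Qed.

End gaussian_vector.

(** * Linear images of Gaussian vectors, up to equality in law *)

Section gaussian_image.
Context {R : realType}.

(** Equality in law of the two images, stated through nonnegative test functions; the widths may
    differ, as the passage to a square matrix requires. *)
Definition same_gaussian_image m n n' (S : 'M[R]_(m, n)) (S' : 'M[R]_(m, n')) :=
  forall f : 'cV[R]_m -> \bar R, measurable_fun setT f -> (forall x, 0 <= f x) ->
  \int[gauss n]_x f (S *m x) = \int[gauss n']_x f (S' *m x).

Local Notation "S ~~ T" := (same_gaussian_image S T) (at level 70).

Lemma same_gaussian_image_trans m n1 n2 n3 (S1 : 'M[R]_(m, n1))
    (S2 : 'M[R]_(m, n2)) (S3 : 'M[R]_(m, n3)) :
  S1 ~~ S2 -> S2 ~~ S3 -> S1 ~~ S3.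
Proof. by move=> S12 S23 f mf f0; rewrite S12// S23. Qed.

Lemma same_gaussian_image_mulmx p m n n' (A : 'M[R]_(p, m))
    (S : 'M[R]_(m, n)) (S' : 'M[R]_(m, n')) :
  S ~~ S' -> A *m S ~~ A *m S'.
Proof.
move=> SS' f mf f0.
under eq_integral do rewrite -mulmxA.
under [RHS]eq_integral do rewrite -mulmxA.
apply: (SS' (fun y => f (A *m y))) => //.
by apply: measurableT_comp => //; exact: measurable_mulmx.
Qed.

Lemma same_gaussian_image0 m n n' : (0%R : 'M[R]_(m, n)) ~~ (0%R : 'M[R]_(m, n')).
Proof.
move=> f mf f0.
under eq_integral do rewrite mul0mx.
under [RHS]eq_integral do rewrite mul0mx.
by rewrite !integral_probability_cst.
Qed.

Lemma row_mx_vcons m n (s : 'cV[R]_m) (S : 'M[R]_(m, n)) t x :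
  row_mx s S *m vcons (t, x) = (t *: s + S *m x)%R.
Proof. by rewrite /vcons mul_row_col mul_mx_scalar. Qed.

Lemma measurable_addmx d (T : measurableType d) m n (f g : T -> 'M[R]_(m, n)) :
  measurable_fun setT f -> measurable_fun setT g ->
  measurable_fun setT (fun x => f x + g x)%R.
Proof.
move=> mf mg; apply: measurable_fun_mx => i j; under eq_fun do rewrite mxE.
by apply: measurable_funD;
  [exact: (measurableT_comp (measurable_mx_entry i j) mf)|
   exact: (measurableT_comp (measurable_mx_entry i j) mg)].
Qed.

Lemma integral_gauss_row_mx m n (s : 'cV[R]_m) (S : 'M[R]_(m, n)) f :
  measurable_fun setT f -> (forall x, 0 <= f x) ->
  \int[gauss n.+1]_x f (row_mx s S *m x) =
  \int[gauss1]_t \int[gauss n]_x f (t *: s + S *m x)%R.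
Proof.
move=> mf f0.
have mfS : measurable_fun setT (fun x : 'cV[R]_n.+1 => f (row_mx s S *m x)).
  by apply: measurableT_comp => //; exact: measurable_mulmx.
rewrite (ge0_integral_gaussS mfS (fun=> f0 _)).
by apply: eq_integral => t _; apply: eq_integral => x _; rewrite row_mx_vcons.
Qed.

(** Once the coordinate that multiplies [s] is fixed, both images are shifted by the same vector. *)
Lemma same_gaussian_image_row_mx m n n' (s : 'cV[R]_m)
    (S : 'M[R]_(m, n)) (S' : 'M[R]_(m, n')) :
  S ~~ S' -> row_mx s S ~~ row_mx s S'.
Proof.
move=> SS' f mf f0.
rewrite (integral_gauss_row_mx s S mf f0) (integral_gauss_row_mx s S' mf f0).
apply: eq_integral => t _.
apply: (SS' (fun y => f (t *: s + y)%R)) => //.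
by apply: measurableT_comp => //; exact: measurable_addmx.
Qed.

(** Regrouping the new columns around [s] and [t] rotates the coefficients: with coefficients [a],
    [b] they contribute [(c * a - d * b) *: s + (d * a + c * b) *: t]. *)
Lemma same_gaussian_image_rotation m n (s t : 'cV[R]_m) (B : 'M[R]_(m, n)) (c d : R) :
  (c ^+ 2 + d ^+ 2 = 1)%R -> (d != 0)%R ->
  row_mx s (row_mx t B) ~~ row_mx (c *: s + d *: t)%R (row_mx (c *: t - d *: s)%R B).
Proof.
move=> cd d0 f mf f0.
rewrite (integral_gauss_row_mx _ _ mf f0) [RHS](integral_gauss_row_mx _ _ mf f0).
have mft (u : 'cV[R]_m) a : measurable_fun setT (fun y => f (a *: u + y)%R).
  by apply: measurableT_comp => //; exact: measurable_addmx.
under eq_integral => a _.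
  rewrite (integral_gauss_row_mx t B (mft s a) (fun=> f0 _)).
  over.
under [RHS]eq_integral => a _.
  rewrite (integral_gauss_row_mx _ B (mft _ a) (fun=> f0 _)).
  over.
pose G (z : (R * R) * 'cV[R]_n) := f (z.1.1 *: s + (z.1.2 *: t + B *m z.2))%R.
have mscale (u : 'cV[R]_m) (h : (R * R) * 'cV[R]_n -> R) : measurable_fun setT h ->
    measurable_fun setT (fun z => h z *: u)%R.
  move=> mh; apply: measurable_fun_mx => i j; under eq_fun do rewrite mxE.
  exact: measurable_funM.
have mG : measurable_fun setT G.
  apply: measurableT_comp => //; apply: measurable_addmx.
    by apply: mscale; exact: measurableT_comp.
  apply: measurable_addmx; first by apply: mscale; exact: measurableT_comp.
  by apply: measurable_fun_mulmx => //; exact: measurable_snd.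
have G0 z : 0 <= G z by exact: f0.
(* Integrating out the other coordinates leaves a function of two variables, to which the planar
   rotation applies. *)
pose H z := \int[gauss n]_y G (z, y).
have mH : measurable_fun setT H by exact: measurable_fun_fubini_tonelli_F.
have H0 z : 0 <= H z by apply: integral_ge0 => y _; exact: G0.
transitivity (\int[@gauss1 R]_a \int[@gauss1 R]_b H (a, b)); first reflexivity.
apply: (etrans (esym (gauss1_rotation cd d0 mH H0))).
apply: eq_integral => a _; apply: eq_integral => b _; apply: eq_integral => x _.
congr f; rewrite /= !addrA; congr (_ + _)%R.
apply/matrixP => i j; rewrite !mxE; ring.
Qed.

(* A Givens rotation of the first two columns clears the second entry of the
   first row. *)
Lemma clear_first_row m n (S : 'M[R]_(1 + m, 1 + n)) :
  exists (a : 'cV[R]_(1 + m)) (B : 'M[R]_(m, n)), S ~~ row_mx a (col_mx 0 B).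
Proof.
elim: n S => [|n IH] S.
  exists (lsubmx S), 0%R => f mf f0; congr (integral _ _ _); apply/funext => x.
  by congr (f (_ *m _)); rewrite -[LHS]hsubmxK; congr row_mx; rewrite !thinmx0.
(* By induction, [t] is the only column besides [s] that may still meet the first row. *)
have [t [B SB]] := IH (rsubmx S); set s := lsubmx S.
have clear0 (u v : 'cV[R]_(1 + m)) : (v ord0 ord0 = 0)%R ->
    row_mx u (row_mx v (col_mx 0 B)) = row_mx u (col_mx 0 (row_mx (dsubmx v) B)).
  move=> v0; congr row_mx; rewrite -[v in LHS]vsubmxK -block_mxEh block_mxEv.
  congr col_mx; rewrite -[RHS]row_mx0; congr row_mx.
  apply/matrixP => i j; rewrite !ord1 !mxE -[RHS]v0.
  by congr (fun_of_matrix _ _ _); exact: val_inj.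
have {IH}Sst : S ~~ row_mx s (row_mx t (col_mx 0 B)).
  by rewrite -[S]hsubmxK; exact: same_gaussian_image_row_mx.
(* This entry is proportional to the sine of the rotation, which has to be nonzero; if it vanishes,
   the row is already clear. *)
have [t0|t0] := eqVneq (t ord0 ord0) 0%R.
  by exists s, (row_mx (dsubmx t) B); rewrite -clear0.
set x := s ord0 ord0 in Sst *; set y := t ord0 ord0 in t0 Sst *.
pose r := Num.sqrt (x ^+ 2 + y ^+ 2).
have r2 : (r ^+ 2 = x ^+ 2 + y ^+ 2)%R by rewrite sqr_sqrtr// addr_ge0 ?sqr_ge0.
have r0 : (r != 0)%R.
  by rewrite gt_eqF// sqrtr_gt0 ltr_wpDl ?sqr_ge0// exprn_even_gt0.
(* Cosine [x / r] and sine [y / r] send the first-row entries [x], [y] to [r], [0]. *)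
exists ((x / r) *: s + (y / r) *: t)%R,
  (row_mx (dsubmx ((x / r) *: t - (y / r) *: s)%R) B).
apply: (same_gaussian_image_trans Sst); rewrite -clear0; last first.
  have -> (u v : 'cV[R]_(1 + m)) (p q : R) : ((p *: u - q *: v) ord0 ord0 =
      p * u ord0 ord0 - q * v ord0 ord0 :> R)%R by rewrite !mxE.
  by rewrite -/x -/y; field.
apply: same_gaussian_image_rotation; last by rewrite mulf_neq0 ?invr_neq0.
by rewrite !expr_div_n -mulrDl -r2 divff// expf_neq0.
Qed.

(** Clearing one row after another is an LQ factorization in law: surplus columns end up zero and
    missing ones are filled with zeros, so wide, tall and rank-deficient matrices are treated
    alike. *)
Lemma same_gaussian_image_square m n (S : 'M[R]_(m, n)) :
  exists A : 'M[R]_m, S ~~ A.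
Proof.
elim: m n S => [|m IH] n S.
  by exists 0%R; rewrite [S]flatmx0; exact: same_gaussian_image0.
case: n S => [|n] S.
  by exists 0%R; rewrite [S]thinmx0; exact: same_gaussian_image0.
have [a [B SB]] := clear_first_row S; have [A BA] := IH _ B.
(* Multiplication by [J] puts a zero row on top; the induction hypothesis for [B] is thereby
   transported to [col_mx 0 B]. *)
pose J : 'M[R]_(1 + m, m) := col_mx 0 1%:M.
exists (row_mx a (J *m A)); apply: (same_gaussian_image_trans SB).
rewrite -[X in row_mx a (col_mx _ X)]mul1mx -[X in row_mx a (col_mx X _)](mul0mx _ B).
rewrite -mul_col_mx; apply: same_gaussian_image_row_mx.
exact: same_gaussian_image_mulmx.
Qed.

End gaussian_image.

(** * The likelihood ratio of a dilated Gaussian vector *)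

Section gaussian_scaling.
Context {R : realType}.

Definition vscale_ratio n (a : R) (x : 'cV[R]_n) : R :=
  (\prod_(i < n) scale_ratio a (x i ord0))%R.

Lemma scale_ratio_ge0 (a x : R) : (0 < a)%R -> (0 <= scale_ratio a x)%R.
Proof. by move=> a0; rewrite mulr_ge0 ?expR_ge0// invr_ge0 ltW. Qed.

Lemma vscale_ratio_ge0 n a (x : 'cV[R]_n) : (0 < a)%R -> (0 <= vscale_ratio a x)%R.
Proof. by move=> a0; apply: prodr_ge0 => i _; exact: scale_ratio_ge0. Qed.

Lemma measurable_vscale_ratio n a : measurable_fun setT (@vscale_ratio n a).
Proof.
apply: measurable_prod => i _.
apply: (measurableT_comp (measurable_scale_ratio a)).
exact: measurable_mx_entry.
Qed.

Lemma scale_vcons n (a t : R) (x : 'cV[R]_n) :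
  (a *: vcons (t, x) = vcons (a * t, a *: x))%R.
Proof. by have := scale_col_mx a t%:M x; rewrite scale_scalar_mx. Qed.

Lemma ge0_integral_gauss_scale n (a : R) (f : 'cV[R]_n -> \bar R) : (0 < a)%R ->
  measurable_fun setT f -> (forall x, 0 <= f x) ->
  \int[gauss n]_x f (a *: x)%R = \int[gauss n]_x (f x * (vscale_ratio a x)%:E).
Proof.
move=> a0; elim: n f => [|n IH] f mf f0.
  apply: eq_integral => x _; rewrite [x]flatmx0 scaler0.
  by rewrite /vscale_ratio big_ord0 mule1.
have mfa : measurable_fun setT (fun x : 'cV[R]_n.+1 => f (a *: x)%R).
  by apply: measurableT_comp => //; exact: measurable_scalemx.
have mfL : measurable_fun setT (fun x : 'cV[R]_n.+1 => f x * (vscale_ratio a x)%:E).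
  by apply: emeasurable_funM => //; apply/measurable_EFinP; exact: measurable_vscale_ratio.
have fL0 x : 0 <= f x * (vscale_ratio a x)%:E.
  by rewrite mule_ge0// lee_fin vscale_ratio_ge0.
rewrite (ge0_integral_gaussS mfa (fun=> f0 _)) (ge0_integral_gaussS mfL fL0).
have mfv : measurable_fun setT (f \o @vcons R n).
  by apply: measurableT_comp => //; exact: measurable_vcons.
have mft t : measurable_fun setT (fun x => f (vcons (t, x))).
  exact: (measurable_fun_pair2 t mfv).
pose g (z : R * 'cV[R]_n) := f (vcons z) * (vscale_ratio a z.2)%:E.
have g0 z : 0 <= g z by rewrite mule_ge0// lee_fin vscale_ratio_ge0.
have mg : measurable_fun setT g.
  apply: emeasurable_funM => //; apply/measurable_EFinP.
  by apply: measurableT_comp measurable_snd; exact: measurable_vscale_ratio.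
(* [h] already contains the ratio of the remaining coordinates; what is left is the one-dimensional
   change of measure in [t]. *)
pose h t := \int[gauss n]_x g (t, x).
have mh : measurable_fun setT h by exact: measurable_fun_fubini_tonelli_F.
have h0 t : 0 <= h t by apply: integral_ge0 => x _; exact: g0.
transitivity (\int[gauss1]_t h (a * t)%R).
  apply: eq_integral => t _; rewrite /h /g/=.
  rewrite -(IH (fun x => f (vcons (a * t, x)%R)) (mft _) (fun=> f0 _)).
  apply: eq_integral => x _; congr f; exact: scale_vcons.
rewrite (ge0_integral_gauss1_scale a0 mh h0).
apply: eq_integral => t _; rewrite /h.
have mgt : measurable_fun setT (fun x => g (t, x)) by exact: (measurable_fun_pair2 t mg).
rewrite -ge0_integralZr; [|exact: measurableT|exact: mgt|by move=> x _; exact: g0|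
  by rewrite lee_fin scale_ratio_ge0].
apply: eq_integral => x _; rewrite /g /= -muleA -EFinM; congr (_ * _%:E).
rewrite /vscale_ratio big_ord_recl vcons0/= mulrC; congr (_ * _)%R.
by apply: eq_bigr => i _; rewrite vconsS.
Qed.

(** The integral is exactly [(1 - u) ^ (- 1/2)] with [u = (a ^+ 2 - 1) ^+ 2]. The bound on [a] keeps
    the exponent of the squared ratio integrable and [u] at most 1/2. *)
Lemma integral_gauss1_scale_ratio_sqr (a : R) : (1 <= a)%R -> (a ^+ 2 <= 3 / 2)%R ->
  \int[@gauss1 R]_x (scale_ratio a x ^+ 2)%:E <= (expR ((a ^+ 2 - 1) ^+ 2))%:E.
Proof.
move=> a1 a2; have a0 : (0 < a)%R by lra.
have a20 : (0 < a ^+ 2)%R by rewrite exprn_gt0.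
set c := (1 - a ^- 2)%R.
have c2 : (c < 2^-1)%R.
  have : ((3 / 2)^-1 <= (a ^+ 2)^-1)%R by rewrite lef_pV2// posrE; lra.
  by rewrite /c; lra.
have -> : \int[@gauss1 R]_x (scale_ratio a x ^+ 2)%:E =
    \int[@gauss1 R]_x ((a ^- 2)%:E * (expR (c * x ^+ 2))%:E).
  apply: eq_integral => x _; rewrite -EFinM; congr EFin.
  rewrite /scale_ratio exprMn -expRM_natl mulrC exprVn; congr (_ * expR _)%R.
  by rewrite /c; field; rewrite gt_eqF.
have mexp : measurable_fun setT (fun x : R => (expR (c * x ^+ 2))%:E).
  apply/measurable_EFinP; apply: measurableT_comp => //.
  by apply: measurable_funM => //; exact: measurable_funX.
rewrite ge0_integralZl_EFin; [|exact: measurableT|by move=> x _; rewrite lee_fin expR_ge0|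
  exact: mexp|by rewrite invr_ge0 ltW].
rewrite integral_gauss1_expR_sqr// -EFinM lee_fin.
set u := ((a ^+ 2 - 1) ^+ 2)%R.
have u0 : (0 <= u)%R by exact: sqr_ge0.
have u2 : (u <= 2^-1)%R.
  have a21 : (1 <= a ^+ 2)%R by rewrite exprn_ege1.
  have : (u <= (1 / 2) ^+ 2)%R by rewrite /u lerXn2r ?nnegrE//; lra.
  by lra.
rewrite -(@ler_pXn2r _ 2)// ?nnegrE ?expR_ge0//; last first.
  by rewrite mulr_ge0// ?invr_ge0 ?sqrtr_ge0// ltW.
have c20 : (0 <= 1 - c *+ 2)%R by move: (c) c2 => ? ?; lra.
rewrite exprMn !exprVn sqr_sqrtr//.
have u1 : (0 < 1 - (a ^+ 2 - 1) ^+ 2)%R by move: u2; rewrite /u; lra.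
have -> : ((a ^+ 2) ^- 2 / (1 - c *+ 2) = (1 - u)^-1)%R.
  rewrite /c /u; field; rewrite ?(gt_eqF a0) ?(gt_eqF u1)//=.
  by rewrite gt_eqF//; lra.
rewrite -expRM_natl -[leLHS]mul1r ler_pdivrMr; last by lra.
(* After squaring, the claim is [1 <= expR (2 * u) * (1 - u)], and [(1 + 2 * u) * (1 - u) >= 1] for
   [0 <= u <= 1/2]. *)
have : (1 + 2 * u <= expR (2%:R * u))%R by exact: expR_ge1Dx.
move: (expR _) => e he.
have : ((1 + 2 * u) * (1 - u) <= e * (1 - u))%R by rewrite ler_wpM2r//; lra.
nra.
Qed.

Lemma integral_gauss_vscale_ratio_sqr n (a : R) : (1 <= a)%R -> (a ^+ 2 <= 3 / 2)%R ->
  \int[gauss n]_x (vscale_ratio a x ^+ 2)%:E <=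
  (expR (n%:R * (a ^+ 2 - 1) ^+ 2))%:E.
Proof.
move=> a1 a2.
have mr2 : measurable_fun setT (fun t : R => (scale_ratio a t ^+ 2)%:E).
  apply/measurable_EFinP; apply: measurable_funX; exact: measurable_scale_ratio.
have r20 (t : R) : 0 <= (scale_ratio a t ^+ 2)%:E by rewrite lee_fin sqr_ge0.
have -> : \int[gauss n]_x (vscale_ratio a x ^+ 2)%:E =
    \int[gauss n]_x \prod_(i < n) (scale_ratio a (x i ord0) ^+ 2)%:E.
  by apply: eq_integral => x _; rewrite /vscale_ratio -prodrXl prodEFin.
rewrite (integral_gauss_prod n mr2 r20) expRM_natl EFin_expe.
set I := \int[_]_t _; have I0 : 0 <= I by apply: integral_ge0 => x _; exact: r20.
have I1 : I <= (expR ((a ^+ 2 - 1) ^+ 2))%:E by exact: integral_gauss1_scale_ratio_sqr.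
elim: n => [|n IH]; first by rewrite !expe0.
by rewrite !expeS lee_pmul// expe_ge0.
Qed.

(* [L <= 1 / (2 t) + t L^2 / 2] turns the second moment of the likelihood ratio
   [L] of [a A w] against [A w] into a comparison of probabilities. *)
Lemma integral_gauss_mulmx_scale m n (S : 'M[R]_(m, n)) (a t : R) (q : 'cV[R]_m -> \bar R) :
  (1 <= a)%R -> (a ^+ 2 <= 3 / 2)%R -> (0 < t)%R ->
  measurable_fun setT q -> (forall y, 0 <= q y) -> (forall y, q y <= 1) ->
  \int[gauss n]_x q (S *m (a *: x)%R) <=
  ((2 * t)^-1)%:E * \int[gauss n]_x q (S *m x) +
  (t / 2 * expR (m%:R * (a ^+ 2 - 1) ^+ 2))%:E.
Proof.
move=> a1 a2 t0 mq q0 q1; have a0 : (0 < a)%R by lra.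
have [A SA] := same_gaussian_image_square S.
have mqa : measurable_fun setT (fun y : 'cV[R]_m => q (a *: y)%R).
  by apply: measurableT_comp => //; exact: measurable_scalemx.
have mqA : measurable_fun setT (fun y : 'cV[R]_m => q (A *m y)).
  by apply: measurableT_comp => //; exact: measurable_mulmx.
(* The scalar is pulled out of [S] so that the law of [S x] can be replaced, then pushed into [A]:
   the dilation now acts on [m] coordinates instead of [n]. *)
under eq_integral do rewrite -scalemxAr.
rewrite (SA _ mqa (fun=> q0 _)) (SA _ mq q0).
under eq_integral do rewrite scalemxAr.
rewrite (ge0_integral_gauss_scale a0 mqA (fun=> q0 _)).
have mL2 : measurable_fun setT (fun y : 'cV[R]_m => (t / 2 * vscale_ratio a y ^+ 2)%:E).
  apply/measurable_EFinP; apply: measurable_funM => //.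
  by apply: measurable_funX; exact: measurable_vscale_ratio.
have c0 : (0 <= (2 * t)^-1)%R by rewrite invr_ge0; lra.
have t20 : (0 <= t / 2)%R by lra.
have mcq : measurable_fun setT (fun y => ((2 * t)^-1)%:E * q (A *m y)).
  exact: measurable_funeM.
have cq0 y : 0 <= ((2 * t)^-1)%:E * q (A *m y) by rewrite mule_ge0// lee_fin.
have L20 (y : 'cV[R]_m) : 0 <= (t / 2 * vscale_ratio a y ^+ 2)%:E.
  by rewrite lee_fin mulr_ge0// sqr_ge0.
apply: (@le_trans _ _ (\int[gauss m]_y (((2 * t)^-1)%:E * q (A *m y) +
    (t / 2 * vscale_ratio a y ^+ 2)%:E))).
  apply: ge0_le_integral; [exact: measurableT| | | | ].
  - by move=> y _; rewrite mule_ge0// lee_fin vscale_ratio_ge0.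
  - apply: emeasurable_funM => //; apply/measurable_EFinP; exact: measurable_vscale_ratio.
  - exact: emeasurable_funD.
  move=> y _; move: (q0 (A *m y)) (q1 (A *m y)); case: (q (A *m y)) => // r.
  rewrite !lee_fin => r0 r1.
  have : (0 <= (1 - t * vscale_ratio a y) ^+ 2)%R by exact: sqr_ge0.
  move: (vscale_ratio_ge0 y a0); move: (vscale_ratio a y) => l l0 sq.
  have l2 : (l <= (2 * t)^-1 + t / 2 * l ^+ 2)%R.
    rewrite -subr_ge0 (_ : _ - l = (1 - t * l) ^+ 2 / (2 * t))%R; last by field; rewrite gt_eqF.
    by rewrite divr_ge0//; lra.
  apply: (@le_trans _ _ (r * ((2 * t)^-1 + t / 2 * l ^+ 2))%R); first by rewrite ler_wpM2l.
  (* [q <= 1] is spent on the quadratic term only; the other term keeps [q] and becomes its mean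
     under the undilated law. *)
  by rewrite mulrDr (mulrC r) lerD// ler_piMl// mulr_ge0// sqr_ge0.
rewrite ge0_integralD; [|exact: measurableT|by []|exact: mcq|by []|exact: mL2].
rewrite ge0_integralZl_EFin; [|exact: measurableT|by []|exact: mqA|exact: c0].
rewrite leeD2l//.
have mL2' : measurable_fun setT (fun y : 'cV[R]_m => (vscale_ratio a y ^+ 2)%:E).
  by apply/measurable_EFinP; apply: measurable_funX; exact: measurable_vscale_ratio.
under eq_integral do rewrite EFinM.
rewrite ge0_integralZl_EFin; [|exact: measurableT|by move=> y _; rewrite lee_fin sqr_ge0|
  exact: mL2'|exact: t20].
rewrite [X in _ <= X]EFinM; apply: lee_wpmul2l; first by rewrite lee_fin.
exact: integral_gauss_vscale_ratio_sqr.
Qed.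

End gaussian_scaling.

(** * Concentration of the moment of a Gaussian vector *)

Section moment_concentration.
Context {R : realType}.

(** From [expR u - 1 <= u * expR u] the excess over [1 + u] is at most [u * (expR u - 1)], and
    [expR u - 1] is at most [|u| * expR |u|] in absolute value. *)
Lemma expR_le_1Dx_sqr (u : R) : (expR u <= 1 + u + u ^+ 2 * expR `|u|)%R.
Proof.
have le1 (v : R) : (expR v - 1 <= v * expR v)%R.
  have : (1 - v <= expR (- v))%R by exact: expR_ge1Dx.
  rewrite expRN -(ler_pM2l (expR_gt0 v)) divff ?gt_eqF ?expR_gt0//; lra.
have abs : (`|expR u - 1| <= `|u| * expR `|u|)%R.
  have [u0|u0] := leP 0%R u.
    have e1 : (1 <= expR u)%R by rewrite -expR0 ler_expR.
    by rewrite !ger0_norm// subr_ge0.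
  have e1 : (expR u <= 1)%R by rewrite -expR0 ler_expR ltW.
  rewrite (ltr0_norm u0) ler0_norm; last by lra.
  have : (1 <= expR (- u))%R by rewrite -expR0 ler_expR; lra.
  by have := expR_ge1Dx u; nra.
have : (u * (expR u - 1) <= u ^+ 2 * expR `|u|)%R.
  apply: (le_trans (ler_norm _)); rewrite normrM -real_normK ?num_real//.
  by rewrite expr2 -mulrA ler_wpM2l.
by have := le1 u; lra.
Qed.

(** Chernoff's bound: the indicator is at most the exponential of the sum minus [c], whose integral
    factors. The tilt is part of [f], so both tails are instances. *)
Lemma gauss_sum_ge_le n (f : R -> R) (b c : R) : measurable_fun setT f ->
  \int[@gauss1 R]_t (expR (f t))%:E <= (expR b)%:E ->
  gauss n [set x : 'cV[R]_n | (c <= \sum_(i < n) f (x i ord0))%R] <=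
    (expR (n%:R * b - c))%:E.
Proof.
move=> mf fb; set A := [set x | _].
have mF : measurable_fun setT (fun x : 'cV[R]_n => \sum_(i < n) f (x i ord0))%R.
  by apply: measurable_sum => i; apply: (measurableT_comp mf); exact: measurable_mx_entry.
have mA : measurable A.
  rewrite -[A]setTI (_ : A = (fun x : 'cV[R]_n => \sum_(i < n) f (x i ord0))%R @^-1` `[c, +oo[).
    by apply: mF => //; exact: measurable_itv.
  by apply/seteqP; split => x /=; rewrite in_itv/= andbT.
have mef : measurable_fun setT (fun t => (expR (f t))%:E).
  by apply/measurable_EFinP; exact: measurableT_comp.
have ef0 t : 0 <= (expR (f t))%:E by rewrite lee_fin expR_ge0.
rewrite -[A]setIT -integral_indic//.
apply: (@le_trans _ _ (\int[gauss n]_x ((expR (- c))%:E *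
    \prod_(i < n) (expR (f (x i ord0)))%:E))).
  apply: ge0_le_integral; [exact: measurableT|by move=> x _; rewrite lee_fin|
    by apply/measurable_EFinP; exact: measurable_indic| |].
    rewrite (_ : (fun _ => _) = fun x : 'cV[R]_n => (expR (- c) * expR (\sum_(i < n) f (x i ord0)))%:E).
      apply/measurable_EFinP; apply: measurable_funM => //; exact: measurableT_comp.
    by apply/funext => x; rewrite prodEFin expR_sum EFinM.
  move=> x _; rewrite prodEFin -expR_sum -EFinM lee_fin -expRD indicE.
  have [|] := boolP (x \in A); last by rewrite expR_ge0.
  rewrite inE /A /= => cf; rewrite -[X in (X%:R <= _)%R]/(1%N) -expR0 ler_expR; lra.
rewrite ge0_integralZl_EFin; [|exact: measurableT| | |exact: expR_ge0]; last 2 first.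
- by move=> x _; rewrite prodEFin lee_fin prodr_ge0// => i _; exact: expR_ge0.
- rewrite (_ : (fun _ => _) = fun x : 'cV[R]_n => (expR (\sum_(i < n) f (x i ord0)))%:E).
    by apply/measurable_EFinP; exact: measurableT_comp.
  by apply/funext => x; rewrite prodEFin expR_sum.
rewrite (integral_gauss_prod n mef ef0) addrC expRD expRM_natl EFinM EFin_expe.
apply: lee_wpmul2l; first by rewrite lee_fin expR_ge0.
set I := \int[_]_t _ in fb *; have I0 : 0 <= I by apply: integral_ge0 => x _; exact: ef0.
elim: n {A mF mA} => [|n IH]; first by rewrite !expe0.
by rewrite !expeS lee_pmul// expe_ge0.
Qed.

Variable p : R.
Hypotheses (p1 : (1 <= p)%R) (p2 : (p < 2)%R).

Let p0 : (0 <= p)%R := le_trans ler01 p1.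

Let phi (t : R) : R := (`|t| `^ p)%R.

Let measurable_phi : measurable_fun setT phi.
Proof. by apply: (measurableT_comp (measurable_powR p)). Qed.

Let phi_ge0 t : (0 <= phi t)%R. Proof. exact: powR_ge0. Qed.

Let phi_le t : (phi t <= 1 + t ^+ 2)%R.
Proof.
have [t1|t1] := leP `|t|%R 1%R.
  have : (phi t <= 1 `^ p)%R by apply: (ge0_ler_powR p0); rewrite ?nnegrE// ltW.
  by rewrite powR1 => h; apply: (le_trans h); rewrite lerDl sqr_ge0.
have : (phi t <= `|t| `^ 2%:R)%R by apply: ler_powR; exact: ltW.
by rewrite powR_mulrn// real_normK ?num_real// => h; apply: (le_trans h); rewrite lerDr.
Qed.

(** This minorant has a Gaussian mean in closed form. For [|t| < 1] it comes from [t ^+ 2 <= phi t],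
    by [p < 2]. *)
Let phi_ge t : (1 - expR (- 1 * t ^+ 2) <= phi t)%R.
Proof.
have [t1|t1] := leP 1%R `|t|%R.
  have : (1 `^ p <= phi t)%R by apply: (ge0_ler_powR p0); rewrite ?nnegrE// ltW.
  by rewrite powR1; have := expR_gt0 (- 1 * t ^+ 2)%R; lra.
have [->|t0] := eqVneq t 0%R.
  by rewrite expr0n mulr0 expR0 subrr.
have : (`|t| `^ 2%:R <= phi t)%R.
  by apply: ger_powR; rewrite ?normr_gt0 ?t0/= ?ltW.
rewrite powR_mulrn// real_normK ?num_real//.
by have := expR_ge1Dx (- 1 * t ^+ 2)%R; lra.
Qed.

(** An integrable majorant uniform in [l <= 1/8]. The inequality [x ^+ 2 / 2 <= expR x] at
    [x = phi t / 8] gives the 128 and one factor [expR (phi t / 8)], the tilt gives another, and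
    [phi t <= 1 + t ^+ 2] bounds their product; 1/4 is below the threshold 1/2 of Gaussian
    integrability. *)
Let bound (t : R) : R := (128 * expR 4^-1 * expR (4^-1 * t ^+ 2))%R.

Let phi_sqr_le (l t : R) : (0 <= l)%R -> (l <= 8^-1)%R ->
  (phi t ^+ 2 * expR (l * phi t) <= bound t)%R.
Proof.
move=> l0 l8; have f0 := phi_ge0 t.
have h1 : (phi t ^+ 2 <= 128 * expR (8^-1 * phi t))%R.
  have : (0 <= 8^-1 * phi t)%R by lra.
  by move=> /(expR_ge1Dxn 1); rewrite (_ : 2`!%:R = 2%:R :> R)%R//; lra.
have h2 : (expR (l * phi t) <= expR (8^-1 * phi t))%R by rewrite ler_expR ler_wpM2r.
apply: (@le_trans _ _ (128 * expR (8^-1 * phi t) * expR (8^-1 * phi t))%R).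
  by rewrite ler_pM// ?sqr_ge0 ?expR_ge0.
rewrite /bound -!mulrA -!expRD ler_wpM2l// ler_expR.
by have := phi_le t; lra.
Qed.

Let phi_le_bound t : (phi t <= bound t)%R.
Proof.
have := phi_le t; have := expR_ge1Dx (4^-1 * t ^+ 2)%R.
have : (1 <= expR 4^-1 :> R)%R by rewrite -expR0 ler_expR invr_ge0.
have : (0 <= t ^+ 2)%R by exact: sqr_ge0.
rewrite /bound; move: (phi t) (t ^+ 2)%R (expR (4^-1 * _))%R (expR 4^-1)%R => f z y x; nra.
Qed.

Let K : R := (128 * expR 4^-1 * (Num.sqrt (1 - 4^-1 *+ 2))^-1)%R.

Let measurable_bound : measurable_fun setT bound.
Proof.
apply: measurable_funM => //; apply: measurableT_comp => //.
by apply: measurable_funM => //; exact: measurable_funX.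
Qed.

Let bound_ge0 t : (0 <= bound t)%R.
Proof. by rewrite !mulr_ge0 ?expR_ge0. Qed.

Let integral_bound : \int[@gauss1 R]_t (bound t)%:E = K%:E.
Proof.
rewrite /bound; under eq_integral do rewrite EFinM.
rewrite ge0_integralZl_EFin; [|exact: measurableT| | |]; first last.
- by rewrite mulr_ge0 ?expR_ge0.
- apply/measurable_EFinP; apply: measurableT_comp => //.
  by apply: measurable_funM => //; exact: measurable_funX.
- by move=> t _; rewrite lee_fin expR_ge0.
by rewrite integral_gauss1_expR_sqr -?EFinM//; lra.
Qed.

Let emeasurable_phi : measurable_fun setT (EFin \o phi).
Proof. exact/measurable_EFinP. Qed.

Definition gauss_moment : R := fine (\int[@gauss1 R]_t (phi t)%:E).
Local Notation mu := gauss_moment.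

Let integral_phi_le : \int[@gauss1 R]_t (phi t)%:E <= K%:E.
Proof.
rewrite -integral_bound; apply: ge0_le_integral; [exact: measurableT| | | |].
- by move=> t _; rewrite lee_fin.
- exact: emeasurable_phi.
- exact/measurable_EFinP.
- by move=> t _; rewrite lee_fin.
Qed.

Let gauss_momentE : \int[@gauss1 R]_t (phi t)%:E = mu%:E.
Proof.
rewrite fineK// ge0_fin_numE; first exact: le_lt_trans integral_phi_le (ltry _).
by apply: integral_ge0 => t _; rewrite lee_fin.
Qed.

Let integralZ_phi l : (0 <= l)%R ->
  \int[@gauss1 R]_t (l%:E * (phi t)%:E) = (l * mu)%:E.
Proof.
move=> l0; rewrite ge0_integralZl_EFin; [|exact: measurableT|by move=> t _; rewrite lee_fin|
  exact: emeasurable_phi|exact: l0].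
by rewrite gauss_momentE.
Qed.

Let integralZ_bound l : (0 <= l)%R ->
  \int[@gauss1 R]_t (l%:E * (bound t)%:E) = (l * K)%:E.
Proof.
move=> l0; rewrite ge0_integralZl_EFin; [|exact: measurableT|by move=> t _; rewrite lee_fin|
  by apply/measurable_EFinP|exact: l0].
by rewrite integral_bound.
Qed.

Let mu_le : (mu <= K)%R.
Proof. by rewrite -lee_fin -gauss_momentE. Qed.

(** Integrating [phi_ge] gives [1 <= mu + 1 / sqrt 3]. *)
Lemma gauss_moment_gt0 : (0 < mu)%R.
Proof.
have mexp : measurable_fun setT (fun t : R => (expR (- 1 * t ^+ 2))%:E).
  apply/measurable_EFinP; apply: measurableT_comp => //.
  by apply: measurable_funM => //; exact: measurable_funX.
have : \int[@gauss1 R]_t (cst 1 t) <= \int[@gauss1 R]_t ((phi t)%:E + (expR (- 1 * t ^+ 2))%:E).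
  apply: ge0_le_integral; [exact: measurableT|by []|exact: measurable_cst| |].
  - exact: emeasurable_funD.
  - by move=> t _; rewrite -EFinD lee_fin; have := phi_ge t; lra.
rewrite integral_probability_cst.
rewrite ge0_integralD; [|exact: measurableT|by move=> t _; rewrite lee_fin|exact: emeasurable_phi|
  by move=> t _; rewrite lee_fin expR_ge0|exact: mexp].
rewrite gauss_momentE integral_gauss1_expR_sqr; last by lra.
rewrite -EFinD lee_fin; set s := Num.sqrt _.
have s1 : (1 < s)%R by rewrite -[ltLHS]sqrtr1 ltr_sqrt; lra.
have : (s^-1 < 1)%R by rewrite invf_lt1//; lra.
lra.
Qed.

Let exp_phi_le (l : R) : (0 <= l)%R -> (l <= 8^-1)%R ->
  \int[@gauss1 R]_t (expR (l * phi t))%:E <= (expR (l * mu + l ^+ 2 * K))%:E.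
Proof.
move=> l0 l8.
have l20 : (0 <= l ^+ 2)%R by exact: sqr_ge0.
have mlb : measurable_fun setT (fun t => (l ^+ 2)%:E * (bound t)%:E).
  by apply: measurable_funeM; exact/measurable_EFinP.
have mlp : measurable_fun setT (fun t => l%:E * (phi t)%:E).
  exact: measurable_funeM.
have lb0 t : 0 <= (l ^+ 2)%:E * (bound t)%:E by rewrite -EFinM lee_fin mulr_ge0.
have lp0 t : 0 <= l%:E * (phi t)%:E by rewrite -EFinM lee_fin mulr_ge0.
apply: (@le_trans _ _ (\int[@gauss1 R]_t (cst 1 t + (l%:E * (phi t)%:E + (l ^+ 2)%:E * (bound t)%:E)))).
  apply: ge0_le_integral; [exact: measurableT|by move=> t _; rewrite lee_fin expR_ge0| | |].
  - apply/measurable_EFinP; apply: measurableT_comp => //; exact: measurable_funM.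
  - by apply: emeasurable_funD; [exact: measurable_cst|exact: emeasurable_funD].
  - move=> t _; rewrite -!EFinM -!EFinD lee_fin; apply: (le_trans (expR_le_1Dx_sqr _)).
    rewrite -addrA !lerD2l ger0_norm ?mulr_ge0// exprMn -mulrA ler_wpM2l//.
    exact: phi_sqr_le.
rewrite ge0_integralD; [|exact: measurableT|by []|exact: measurable_cst|
  by move=> t _; rewrite adde_ge0|exact: emeasurable_funD].
rewrite ge0_integralD; [|exact: measurableT|by move=> t _; exact: lp0|exact: mlp|by move=> t _; exact: lb0|exact: mlb].
rewrite integralZ_phi// integralZ_bound// integral_probability_cst -!EFinD lee_fin.
exact: expR_ge1Dx.
Qed.

Let exp_Nphi_le (l : R) : (0 <= l)%R -> (l <= 8^-1)%R ->
  \int[@gauss1 R]_t (expR (- l * phi t))%:E <= (expR (- l * mu + l ^+ 2 * K))%:E.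
Proof.
move=> l0 l8.
have l20 : (0 <= l ^+ 2)%R by exact: sqr_ge0.
have mlb : measurable_fun setT (fun t => (l ^+ 2)%:E * (bound t)%:E).
  by apply: measurable_funeM; exact/measurable_EFinP.
have mlp : measurable_fun setT (fun t => l%:E * (phi t)%:E).
  exact: measurable_funeM.
have me : measurable_fun setT (fun t => (expR (- l * phi t))%:E).
  by apply/measurable_EFinP; apply: measurableT_comp => //; exact: measurable_funM.
have lb0 t : 0 <= (l ^+ 2)%:E * (bound t)%:E by rewrite -EFinM lee_fin mulr_ge0.
have lp0 t : 0 <= l%:E * (phi t)%:E by rewrite -EFinM lee_fin mulr_ge0.
have e0 t : 0 <= (expR (- l * phi t))%:E by rewrite lee_fin expR_ge0.
(* The linear term, now negative, is moved to the left so that both integrands stay nonnegative. *)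
have : \int[@gauss1 R]_t ((expR (- l * phi t))%:E + l%:E * (phi t)%:E) <=
    \int[@gauss1 R]_t (cst 1 t + (l ^+ 2)%:E * (bound t)%:E).
  apply: ge0_le_integral; [exact: measurableT|by move=> t _; rewrite adde_ge0| | |].
  - exact: emeasurable_funD.
  - by apply: emeasurable_funD; [exact: measurable_cst|].
  - move=> t _; rewrite -!EFinM -!EFinD lee_fin.
    have := expR_le_1Dx_sqr (- l * phi t); rewrite mulNr normrN sqrrN.
    rewrite ger0_norm ?mulr_ge0// exprMn -mulrA.
    have := ler_wpM2l l20 (phi_sqr_le t l0 l8); lra.
rewrite ge0_integralD; [|exact: measurableT|by []|exact: me|by []|exact: mlp].
rewrite [in leRHS]ge0_integralD; [|exact: measurableT|by []|exact: measurable_cst|by []|exact: mlb].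
rewrite integralZ_phi// integralZ_bound// integral_probability_cst -EFinD -leeBrDr// -EFinB => h.
apply: (le_trans h); rewrite lee_fin (_ : 1 + _ - _ = 1 + (- l * mu + l ^+ 2 * K))%R; last lra.
exact: expR_ge1Dx.
Qed.

Lemma gauss_moment_concentration : exists2 c : R, (0 < c)%R & forall n (eps : R),
  (0 < eps)%R -> (eps <= 4^-1)%R ->
  gauss n [set x | ((1 + eps) * (n%:R * mu) <= moment p x)%R] <=
    (expR (- (c * n%:R * eps ^+ 2)))%:E /\
  gauss n [set x | (moment p x <= (1 - eps) * (n%:R * mu))%R] <=
    (expR (- (c * n%:R * eps ^+ 2)))%:E.
Proof.
have mu0 := gauss_moment_gt0; have K0 : (0 < K)%R by exact: lt_le_trans mu0 mu_le.
exists (mu ^+ 2 / (4 * K))%R; first by rewrite divr_gt0 ?exprn_gt0// mulr_gt0.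
(* This [l] minimizes [l ^+ 2 * K - l * eps * mu]; [mu <= K] and [eps <= 1/4] keep it at most
   1/8. *)
move=> n eps e0 e4; pose l := (eps * mu / (2 * K))%R.
have l0 : (0 < l)%R by apply: divr_gt0; apply: mulr_gt0.
have l8 : (l <= 8^-1)%R.
  rewrite ler_pdivrMr; last exact: mulr_gt0.
  have := mu_le.
  by move: (mu) (K) K0 mu0 => u k k0 u0; nra.
have lE : (l ^+ 2 * K - l * eps * mu = - (mu ^+ 2 / (4 * K) * eps ^+ 2))%R.
  by rewrite /l; move: (K) K0 => k k0; field; rewrite gt_eqF.
have sumE (k : R) (x : 'cV[R]_n) : (\sum_(i < n) k * phi (x i ord0) = k * moment p x)%R.
  by rewrite /moment mulr_sumr.
split.
- have := gauss_sum_ge_le n (l * ((1 + eps) * (n%:R * mu)))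
    (measurable_funM (measurable_cst l) measurable_phi) (exp_phi_le (ltW l0) l8).
  rewrite (_ : n%:R * _ - _ = - (mu ^+ 2 / (4 * K) * n%:R * eps ^+ 2))%R; last first.
    by transitivity (n%:R * (l ^+ 2 * K - l * eps * mu))%R; [ring|rewrite lE; ring].
  rewrite (_ : [set x | _] = [set x | ((1 + eps) * (n%:R * mu) <= moment p x)%R])//.
  by apply/seteqP; split => x /=; rewrite sumE ler_pM2l.
- have := gauss_sum_ge_le n (- l * ((1 - eps) * (n%:R * mu)))
    (measurable_funM (measurable_cst (- l)%R) measurable_phi) (exp_Nphi_le (ltW l0) l8).
  rewrite (_ : n%:R * _ - _ = - (mu ^+ 2 / (4 * K) * n%:R * eps ^+ 2))%R; last first.
    by transitivity (n%:R * (l ^+ 2 * K - l * eps * mu))%R; [ring|rewrite lE; ring].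
  rewrite (_ : [set x | _] = [set x | (moment p x <= (1 - eps) * (n%:R * mu))%R])//.
  by apply/seteqP; split => x /=; rewrite sumE !mulNr lerN2 ler_pM2l.
Qed.

End moment_concentration.

(** * Measurability on matrices with a varying number of rows *)

Section varmx_measurability.
Context {R : realType} {n : nat}.

Lemma measurable_varmx (A : set (varmx R n)) :
  (forall m, measurable (@VarMx _ R n m @^-1` A)) -> measurable A.
Proof. exact. Qed.

(** A total projection onto the summand of [m] rows, with the default 0 elsewhere; it is only used
    where [tag S = m]. *)
Definition rows_part m (S : varmx R n) : 'M[R]_(m, n) :=
  if tag S =P m is ReflectT e then ecast k 'M[R]_(k, n) e (tagged S) else 0%R.

Lemma rows_part_VarMx m (M : 'M[R]_(m, n)) : rows_part m (VarMx M) = M.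
Proof. by rewrite /rows_part /=; case: eqP => // e; rewrite eq_axiomK. Qed.

Lemma measurable_rows_part m : measurable_fun setT (rows_part m).
Proof.
move=> _ B mB; rewrite setTI; apply: measurable_varmx => k.
have [e|km] := eqVneq k m.
  subst m; rewrite (_ : _ @^-1` _ = B)//.
  by apply/seteqP; split => M /=; rewrite rows_part_VarMx.
have [B0|B0] := pselect (B 0%R).
  rewrite (_ : _ @^-1` _ = setT)//; apply/seteqP; split => // M _ /=.
  by rewrite /rows_part /=; case: eqP => // e; rewrite e eqxx in km.
rewrite (_ : _ @^-1` _ = set0)//; apply/seteqP; split => // M /=.
by rewrite /rows_part /=; case: eqP => // e; rewrite e eqxx in km.
Qed.

Lemma measurable_tag_eq m : measurable [set S : varmx R n | tag S = m].
Proof.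
apply: measurable_varmx => k; have [e|km] := eqVneq k m.
  by subst m; rewrite (_ : _ @^-1` _ = setT)//; apply/seteqP; split.
rewrite (_ : _ @^-1` _ = set0)//; apply/seteqP; split => // M /= e.
by rewrite e eqxx in km.
Qed.

(** The product sigma-algebra is not by definition a sum over [m], so the preimage is cut into the
    countably many pieces [tag S = m], on each of which [rows_part m] gives access to a fixed matrix
    space. *)
Lemma measurable_fun_varmx_prod d d' (T : measurableType d) (T' : measurableType d')
    (f : varmx R n * T -> T') :
  (forall m, measurable_fun setT (fun w : 'M[R]_(m, n) * T => f (VarMx w.1, w.2))) ->
  measurable_fun setT f.
Proof.
move=> mf _ Y mY; rewrite setTI.
pose g m (z : varmx R n * T) := (rows_part m z.1, z.2).
have mg m : measurable_fun setT (g m).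
  apply: measurable_fun_pair; last exact: measurable_snd.
  by apply: measurableT_comp measurable_fst; exact: measurable_rows_part.
rewrite (_ : f @^-1` Y = \bigcup_m ((fst @^-1` [set S | tag S = m]) `&`
    (g m @^-1` ((fun w => f (VarMx w.1, w.2)) @^-1` Y)))); last first.
  apply/seteqP; split => [[[m M] t] /= fY|[S t] [m _ [/= Sm]]].
    by exists m => //; split => //=; rewrite (rows_part_VarMx M).
  by case: S Sm => k M /= <-; rewrite (rows_part_VarMx M).
apply: bigcupT_measurable => m; apply: measurableI.
  by rewrite -[X in measurable X]setTI; apply: measurable_fst => //; exact: measurable_tag_eq.
rewrite -[X in measurable X]setTI; apply: mg => //.
by rewrite -[X in measurable X]setTI; exact: mf.
Qed.

End varmx_measurability.

(** * Output probabilities averaged over a Gaussian input *)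

Section output.
Context {R : realType} {n : nat} (L : linear_sketch R n).
Implicit Types (A B : set R) (x : 'cV[R]_n).

Definition sketch_output (A : set R) (z : varmx R n * 'cV[R]_n) : \bar R :=
  estimator L (tag z.1) (tagged z.1, tagged z.1 *m z.2) A.

Lemma sketch_output_ge0 A z : 0 <= sketch_output A z.
Proof. exact: measure_ge0. Qed.

Lemma estimator_le1 m z A : measurable A -> estimator L m z A <= 1.
Proof.
move=> mA; rewrite -(prob_kernel (s := estimator L m) z).
by apply: le_measure; rewrite ?inE.
Qed.

Lemma measurable_sketch_output A : measurable A -> measurable_fun setT (sketch_output A).
Proof.
move=> mA; apply: measurable_fun_varmx_prod => m.
apply: (@measurableT_comp _ _ _ _ _ _ (fun z => estimator L m z A) _
  (fun w : 'M[R]_(m, n) * 'cV[R]_n => (w.1, w.1 *m w.2))).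
  exact: measurable_kernel.
apply: measurable_fun_pair; first exact: measurable_fst.
by apply: measurable_fun_mulmx; [exact: measurable_fst|exact: measurable_snd].
Qed.

Lemma measurable_sketch_output_fst A x : measurable A ->
  measurable_fun setT (fun S => sketch_output A (S, x)).
Proof. by move=> mA; exact: (measurable_fun_pair1 x (measurable_sketch_output mA)). Qed.

Lemma output_probE x A :
  output_prob L x A = \int[sketch_dist L]_S sketch_output A (S, x).
Proof. by []. Qed.

Lemma output_prob_ge0 x A : 0 <= output_prob L x A.
Proof. by rewrite output_probE; apply: integral_ge0 => S _; exact: sketch_output_ge0. Qed.

Lemma measurable_output_prob A : measurable A ->
  measurable_fun setT (fun x => output_prob L x A).
Proof.
move=> mA; apply: (measurable_fun_fubini_tonelli_G (m1 := sketch_dist L) (sketch_output A)).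
  exact: measurable_sketch_output.
exact: sketch_output_ge0.
Qed.

Lemma le_output_prob x A B : measurable A -> measurable B -> A `<=` B ->
  output_prob L x A <= output_prob L x B.
Proof.
move=> mA mB AB; rewrite !output_probE; apply: ge0_le_integral; [exact: measurableT| | | |].
- by move=> S _; exact: sketch_output_ge0.
- exact: measurable_sketch_output_fst.
- exact: measurable_sketch_output_fst.
- by move=> S _; apply: le_measure; rewrite ?inE.
Qed.

Lemma output_prob_disjoint x A B : measurable A -> measurable B ->
  A `&` B = set0 -> output_prob L x A + output_prob L x B <= 1.
Proof.
move=> mA mB AB; rewrite !output_probE -ge0_integralD; [|exact: measurableT|
  by move=> S _; exact: sketch_output_ge0|exact: measurable_sketch_output_fst|
  by move=> S _; exact: sketch_output_ge0|exact: measurable_sketch_output_fst].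
have -> : 1 = \int[sketch_dist L]_S cst 1 S.
  by rewrite integral_probability_cst.
apply: ge0_le_integral; [exact: measurableT| | |exact: measurable_cst|].
- by move=> S _; rewrite adde_ge0// sketch_output_ge0.
- by apply: emeasurable_funD; exact: measurable_sketch_output_fst.
- move=> S _; rewrite /sketch_output -measureU//.
  by apply: estimator_le1; exact: measurableU.
Qed.

Lemma output_prob_le1 x A : measurable A -> output_prob L x A <= 1.
Proof.
move=> mA; apply: le_trans (output_prob_disjoint x mA measurable0 (setI0 A)).
by rewrite leeDl// output_prob_ge0.
Qed.

(** The comparison of inputs is made for a fixed matrix, hence the integral over [S] must be the
    outer one. *)
Lemma integral_gauss_output_prob A (a : R) : measurable A ->
  \int[gauss n]_x output_prob L (a *: x)%R A =
  \int[sketch_dist L]_S \int[gauss n]_x sketch_output A (S, a *: x)%R.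
Proof.
move=> mA.
pose g (z : varmx R n * 'cV[R]_n) := sketch_output A (z.1, a *: z.2)%R.
have mg : measurable_fun setT g.
  apply: (measurableT_comp (measurable_sketch_output mA)).
  apply: measurable_fun_pair; first exact: measurable_fst.
  exact: (measurable_fun_scalemx a measurable_snd).
exact: (esym (fubini_tonelli (m1 := sketch_dist L) (m2 := gauss n) g mg
  (fun z => sketch_output_ge0 _ _))).
Qed.

Lemma integral_output_prob_scale A (a t r : R) : measurable A ->
  (1 <= a)%R -> (a ^+ 2 <= 3 / 2)%R -> (0 < t)%R ->
  sketching_dim L <= r%:E ->
  \int[gauss n]_x output_prob L (a *: x)%R A <=
  ((2 * t)^-1)%:E * \int[gauss n]_x output_prob L x A +
  (t / 2 * expR (r * (a ^+ 2 - 1) ^+ 2))%:E.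
Proof.
move=> mA a1 a2 t0 Lr.
have mS b : measurable_fun setT (fun S => \int[gauss n]_x sketch_output A (S, b *: x)%R).
  pose g (z : varmx R n * 'cV[R]_n) := sketch_output A (z.1, b *: z.2)%R.
  have mg : measurable_fun setT g.
    apply: (measurableT_comp (measurable_sketch_output mA)).
    apply: measurable_fun_pair; first exact: measurable_fst.
    exact: (measurable_fun_scalemx b measurable_snd).
  exact: (measurable_fun_fubini_tonelli_F g mg (fun z => sketch_output_ge0 _ _)).
have S0 b S : 0 <= \int[gauss n]_x sketch_output A (S, b *: x)%R.
  by apply: integral_ge0 => x _; exact: sketch_output_ge0.
have -> : \int[gauss n]_x output_prob L x A =
    \int[gauss n]_x output_prob L (1 *: x)%R A.
  by apply: eq_integral => x _; rewrite scale1r.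
rewrite !integral_gauss_output_prob//.
set c := ((2 * t)^-1)%R; set e := (t / 2 * _)%R.
have c0 : (0 <= c)%R by rewrite invr_ge0; lra.
have e0 : (0 <= e)%R by rewrite mulr_ge0 ?expR_ge0//; lra.
have mcS : measurable_fun setT
    (fun S => c%:E * \int[gauss n]_x sketch_output A (S, 1 *: x)%R).
  by apply: measurable_funeM; exact: mS.
have cS0 S : 0 <= c%:E * \int[gauss n]_x sketch_output A (S, 1 *: x)%R.
  by rewrite mule_ge0.
apply: (@le_trans _ _ (\int[sketch_dist L]_S
    (c%:E * (\int[gauss n]_x sketch_output A (S, 1 *: x)%R) + cst e%:E S))).
  apply: ae_ge0_le_integral; [exact: measurableT|by move=> S _; exact: S0|exact: mS| | |].
  - by move=> S _; rewrite adde_ge0// lee_fin.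
  - by apply: emeasurable_funD; [exact: mcS|exact: measurable_cst].
  (* The dimension is an essential supremum, so [m <= r] is known for almost every [S] only. *)
  have := ess_sup_ge (sketch_dist L) (fun S => ((tag S)%:R)%:E).
  apply: filterS => -[m M] /= mr _.
  have {}mr : (m%:R <= r)%R by rewrite -lee_fin; exact: le_trans mr Lr.
  have mq : measurable_fun setT (fun y => estimator L m (M, y) A).
    apply: (@measurableT_comp _ _ _ _ _ _ (fun z => estimator L m z A) _ (fun y => (M, y))).
      exact: measurable_kernel.
    exact: pair1_measurable.
  have h := integral_gauss_mulmx_scale M a1 a2 t0 mq
    (fun y => measure_ge0 _ _) (fun y => estimator_le1 _ mA).
  rewrite /sketch_output/=; under [in leRHS]eq_integral do rewrite scale1r.
  apply: (le_trans h); rewrite leeD2l// lee_fin ler_wpM2l//; first by lra.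
  by rewrite ler_expR ler_wpM2r// sqr_ge0.
rewrite ge0_integralD; [|exact: measurableT|by move=> S _; exact: cS0|exact: mcS|
  by move=> S _; rewrite lee_fin|exact: measurable_cst].
rewrite ge0_integralZl_EFin; [|exact: measurableT|by move=> S _; exact: S0|exact: mS|exact: c0].
by rewrite integral_probability_cst.
Qed.

End output.

(** * An accurate sketch as a threshold test *)

Section approximation.
Context {R : realType} {n : nat} (L : linear_sketch R n) (p eps delta : R).
Hypothesis approx : approximates_moment p eps delta L.
Implicit Types (x : 'cV[R]_n) (T : R).

Lemma measurable_ge T : measurable [set y : R | (T <= y)%R].
Proof.
rewrite (_ : [set y | _] = `[T, +oo[%classic); first exact: measurable_itv.
by apply/seteqP; split => y /=; rewrite in_itv/= andbT.
Qed.

Let measurable_approx F : measurable [set y : R | (`|y - F| <= eps * F)%R].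
Proof.
rewrite (_ : [set y | _] = `[(F - eps * F)%R, (F + eps * F)%R]%classic); first exact: measurable_itv.
by apply/seteqP; split => y /=; rewrite in_itv/= ler_distl.
Qed.

(** Accurate outputs stay below [T], so reaching [T] is disjoint from an event of probability at
    least [1 - delta]. *)
Lemma output_prob_ge_small x T : ((1 + eps) * moment p x < T)%R ->
  output_prob L x [set y | (T <= y)%R] <= delta%:E.
Proof.
move=> xT; set F := moment p x in xT *.
have := @output_prob_disjoint _ _ L x _ _ (measurable_approx F) (measurable_ge T).
have /[swap]/[apply] : [set y : R | (`|y - F| <= eps * F)%R] `&` [set y | (T <= y)%R] = set0.
  apply/seteqP; split => // y /= [+ Ty]; rewrite ler_distl => /andP[_ yF].
  have := le_lt_trans (le_trans Ty yF); lra.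
have := approx x; have := output_prob_ge0 L x [set y | (T <= y)%R]; rewrite -/F.
case: (output_prob _ _ _) => [r| |]//; case: (output_prob _ _ _) => [s| |]//.
by rewrite -EFinD !lee_fin; lra.
Qed.

Lemma output_prob_ge_large x T : (T <= (1 - eps) * moment p x)%R ->
  (1 - delta)%:E <= output_prob L x [set y | (T <= y)%R].
Proof.
move=> xT; apply: (le_trans (approx x)); apply: le_output_prob => //.
- exact: measurable_ge.
- move=> y /=; rewrite ler_distl => /andP[Fy _]; apply: (le_trans _ Fy).
  by move: xT; lra.
Qed.

End approximation.

Local Close Scope ereal_scope.
Local Close Scope classical_set_scope.

(** * Choice of constants and the contradiction *)

Lemma momentZ (R : realType) n (p a : R) (x : 'cV[R]_n) : 0 <= a ->
  moment p (a *: x) = a `^ p * moment p x.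
Proof.
move=> a0; rewrite /moment mulr_sumr; apply: eq_bigr => i _.
by rewrite mxE normrM powRM// ger0_norm.
Qed.

Lemma measurable_moment (R : realType) n (p : R) :
  measurable_fun setT (@moment R n p).
Proof.
apply: measurable_sum => i; apply: (measurableT_comp (measurable_powR p)).
by apply: measurableT_comp => //; exact: measurable_mx_entry.
Qed.

Theorem theorem2p5 (R : realType) :
  exists eps0 delta0 : R, 0 < eps0 /\ 0 < delta0 /\
  forall p : R, 1 <= p < 2 ->
  exists C c : R, 0 < C /\ 0 < c /\
  forall (eps delta : R) (n : nat),
    0 < eps < eps0 -> 0 < delta < delta0 ->
    C * (eps ^- 2 * ln delta^-1) <= n%:R ->
    forall L : linear_sketch R n,
      approximates_moment p eps delta L ->
      ((c * (eps ^- 2 * ln delta^-1))%:E <= sketching_dim L)%E.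
Proof.
(* 1/48 gives [a ^+ 2 <= 3 / 2] and [a ^+ 2 - 1 <= 24 * eps] for [a = 1 + 8 * eps]; 1/64 gives
   [delta ^ (- 1/2) <= 1 / (8 * delta)]. *)
exists 48^-1, 64^-1; split; first by rewrite invr_gt0 ltr0n.
split=> [|p /andP[p1 p2]]; first by rewrite invr_gt0 ltr0n.
have [k k0 tail] := gauss_moment_concentration p1 p2.
have mu0 := gauss_moment_gt0 p1 p2; set mu := gauss_moment p in tail mu0.
(* [k^-1] makes each tail of the moment at most [delta]; [1152 = 2 * 24 ^+ 2] makes
   [2 * r * (24 * eps) ^+ 2] equal to [ln delta^-1]. *)
exists k^-1, 1152^-1; split; first by rewrite invr_gt0.
split=> [|eps delta n /andP[e0 e1] /andP[d0 d1] nC L approx]; first by rewrite invr_gt0 ltr0n.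
rewrite leNgt; apply/negP => /ltW Lr.
set r := 1152^-1 * _ in Lr.
(* On each side one factor is lost to concentration and one to the sketch; the dilation makes up for
   all four, as [(1 - eps) ^+ 2 * a >= (1 + eps) ^+ 2]. *)
pose a := 1 + 8 * eps; pose T := (1 + eps) ^+ 2 * (n%:R * mu).
have a1 : 1 <= a by rewrite /a; lra.
have a2 : a ^+ 2 <= 3 / 2 by rewrite /a; nra.
have nmu : 0 <= n%:R * mu by rewrite mulr_ge0// ltW.
have ld : delta = expR (- ln delta^-1) by rewrite lnV ?posrE// opprK lnK.
have tail_le : expR (- (k * n%:R * eps ^+ 2)) <= delta.
  rewrite [leRHS]ld ler_expR lerN2.
  have e2 : 0 < eps ^+ 2 by rewrite exprn_gt0.
  have := ler_wpM2l (ltW (mulr_gt0 k0 e2)) nC.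
  have -> : k * eps ^+ 2 * (k^-1 * (eps ^- 2 * ln delta^-1)) = ln delta^-1.
    by field; rewrite (gt_eqF e0) (gt_eqF k0).
  by rewrite mulrAC.
have e4 : eps <= 4^-1 by lra.
have [] := tail n eps e0 e4.
set A := [set x | _]%classic; set B := [set x | _]%classic.
have mF : measurable_fun setT (@moment R n p) by exact: measurable_moment.
have mA : measurable A.
  rewrite (_ : A = moment p @^-1` `[(1 + eps) * (n%:R * mu), +oo[)%classic.
    by rewrite -[X in measurable X]setTI; apply: mF => //; exact: measurable_itv.
  by apply/seteqP; split => x /=; rewrite in_itv/= andbT.
have mB : measurable B.
  rewrite (_ : B = moment p @^-1` `]-oo, (1 - eps) * (n%:R * mu)])%classic.
    by rewrite -[X in measurable X]setTI; apply: mF => //; exact: measurable_itv.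
  by apply/seteqP; split => x /=; rewrite in_itv/=.
move=> gA gB.
have {}gA : (gauss n A <= delta%:E)%E by apply: (le_trans gA); rewrite lee_fin.
have {}gB : (gauss n B <= delta%:E)%E by apply: (le_trans gB); rewrite lee_fin.
pose Y := [set y : R | T <= y]%classic.
have mY : measurable Y := measurable_ge T.
have mout := measurable_output_prob L mY.
have out0 x : (0 <= output_prob L x Y)%E := output_prob_ge0 L x Y.
have up : (\int[gauss n]_x output_prob L x Y <= (2 * delta)%:E)%E.
  apply: (@le_trans _ _ (\int[gauss n]_x (cst delta%:E x + (\1_A x)%:E))%E).
    apply: ge0_le_integral; [exact: measurableT|by []|exact: mout| |].
      apply: emeasurable_funD; first exact: measurable_cst.
      by apply/measurable_EFinP; exact: measurable_indic.
    move=> x _; rewrite indicE; have [_|xA] := boolP (x \in A).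
      apply: (@le_trans _ _ 1%E); last by rewrite -EFinD lee_fin mulr1n; lra.
      exact: output_prob_le1.
    rewrite adde0; apply: (output_prob_ge_small approx).
    rewrite /T expr2 -mulrA ltr_pM2l; last by lra.
    by rewrite ltNge; apply: contra xA => xA; rewrite inE.
  rewrite ge0_integralD; [|exact: measurableT|by move=> x _; rewrite lee_fin ltW|
    exact: measurable_cst|by move=> x _; rewrite lee_fin|by apply/measurable_EFinP; exact: measurable_indic].
  rewrite integral_indic// setIT integral_probability_cst.
  by rewrite mulr_natl mulr2n EFinD leeD2l.
(* The mass of the exceptional set [B] stands on the right, where the bound is a pointwise
   comparison of nonnegative integrands. *)
have low : ((1 - delta)%:E <= \int[gauss n]_x output_prob L (a *: x) Y + delta%:E)%E.
  have mouta : measurable_fun setT (fun x : 'cV[R]_n => output_prob L (a *: x) Y).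
    apply: (@measurableT_comp _ _ _ _ _ _ (fun x => output_prob L x Y) _
      (fun x : 'cV[R]_n => a *: x)); first exact: mout.
    exact: measurable_scalemx.
  have mi : measurable_fun setT (fun x : 'cV[R]_n => (\1_B x : R)%:E).
    by apply/measurable_EFinP; exact: measurable_indic.
  apply: (@le_trans _ _ (\int[gauss n]_x output_prob L (a *: x) Y + \int[gauss n]_x (\1_B x)%:E)%E); last first.
    by rewrite leeD2l// integral_indic// setIT.
  rewrite -ge0_integralD; [|exact: measurableT|by move=> x _; exact: out0|exact: mouta|
    by move=> x _; rewrite lee_fin|exact: mi].
  have -> : ((1 - delta)%:E = \int[gauss n]_x (cst (1 - delta)%:E x))%E.
    by rewrite integral_probability_cst.
  apply: ge0_le_integral; [exact: measurableT| |exact: measurable_cst|exact: emeasurable_funD|].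
    by move=> x _; rewrite lee_fin; lra.
  move=> x _; rewrite indicE; have [_|xB] := boolP (x \in B).
    by rewrite /= -[leLHS]add0e leeD// lee_fin mulr1n; lra.
  rewrite adde0; apply: (output_prob_ge_large approx).
  have {}xB : (1 - eps) * (n%:R * mu) <= moment p x.
    by rewrite leNgt; apply: contra xB => xB; rewrite inE/=; exact: ltW.
  rewrite momentZ; last by lra.
  have ap : a <= a `^ p by rewrite -[leLHS]powRr1; [exact: ler_powR|lra].
  apply: (@le_trans _ _ ((1 - eps) * (a * ((1 - eps) * (n%:R * mu))))).
    rewrite (_ : _ * (a * _) = (1 - eps) ^+ 2 * a * (n%:R * mu)); last by ring.
    by rewrite ler_wpM2r// /a; nra.
  rewrite ler_wpM2l//; first by lra.
  by rewrite ler_pM//; first [lra|rewrite mulr_ge0//; lra].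
(* With [t = 4 * delta] the false-alarm term is at most [2 * delta / (8 * delta) = 1/4]. *)
have t0 : 0 < 4 * delta by lra.
have := integral_output_prob_scale mY a1 a2 t0 Lr.
set B' := expR _.
have B0 : 0 < B' by exact: expR_gt0.
have B2 : B' ^+ 2 <= delta^-1.
  rewrite -expRM_natl [leRHS](_ : _ = expR (ln delta^-1)); last by rewrite lnK// posrE invr_gt0.
  have ll : 0 <= ln delta^-1.
    by rewrite ln_ge0// -[leLHS]invr1 lef_pV2// ?posrE//; lra.
  have r0 : 0 <= r.
    apply: mulr_ge0; first by rewrite invr_ge0 ler0n.
    by apply: mulr_ge0 => //; rewrite invr_ge0 sqr_ge0.
  have ae1 : 0 <= a ^+ 2 - 1 by rewrite /a; nra.
  have ae2 : a ^+ 2 - 1 <= 24 * eps by rewrite /a; nra.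
  have ae : (a ^+ 2 - 1) ^+ 2 <= (24 * eps) ^+ 2.
    by rewrite lerXn2r ?nnegrE// mulr_ge0 ?ler0n// ltW.
  have rE : 2%:R * (r * (24 * eps) ^+ 2) = ln delta^-1.
    by rewrite /r; field; rewrite (gt_eqF e0).
  by rewrite ler_expR -rE; apply: ler_wpM2l => //; apply: ler_wpM2l.
(* The square of the left side is at most [4 * delta], which is below 1/16. *)
have Bd : 2 * delta * B' <= 4^-1.
  rewrite -(@ler_pXn2r _ 2)// ?nnegrE ?mulr_ge0// ?ltW//.
  have : (2 * delta * B') ^+ 2 <= (2 * delta) ^+ 2 * delta^-1.
    by rewrite exprMn ler_wpM2l// sqr_ge0.
  rewrite (_ : (2 * delta) ^+ 2 * delta^-1 = 4 * delta); last by field; rewrite gt_eqF.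
  lra.
have : (0 <= \int[gauss n]_x output_prob L x Y)%E.
  by apply: integral_ge0 => x _; exact: out0.
move: up low; case: (integral _ _ _) => [u| |]//; case: (integral _ _ _) => [v| |]//.
rewrite -EFinM -!EFinD !lee_fin => uv1 uv2 uv3 uv4.
(* What remains is [1 - 2 * delta <= 1/4 + 1/4], impossible for [delta < 1/64]. *)
have du : (2 * (4 * delta))^-1 * u <= 4^-1.
  rewrite ler_pdivrMl; last by lra.
  lra.
lra.
Qed.
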